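(* Let $\Sigma$ be a closed spacelike 2-surface in a spacetime $N$, let $X$ be an isometric embedding of $\Sigma$ into $\mathbb R^{3,1}$ and $T_0$ a future timelike unit constant vector. Let $b\in\mathbb R^{3,1}$ be a constant vector and consider the isometric embedding $X'=X+b$ (with the same $T_0$). Let $p^\gamma$ be the quasi-local energy-momentum 4-vector with respect to $X$, and let $\Phi^{\alpha\gamma}$ and $\Phi'^{\alpha\gamma}$ be the quasi-local conserved quantities with respect to $X$ and $X'$. Then $$\Phi'^{\alpha\gamma}=\Phi^{\alpha\gamma}-\frac{b^\alpha p^\gamma}2+\frac{b^\gamma p^\alpha}2 .$$
   Context: $\mathbb R^{3,1}$ is Minkowski space with metric $\mathrm{diag}(-1,1,1,1)$. $\Sigma$ has spacelike mean curvature vector $H$, induced metric $\sigma$, and $\alpha_H(\cdot)=\langle\nabla^N_{(\cdot)}\frac J{|H|},\frac H{|H|}\rangle$, where $J$ is the reflection of $H$ through the incoming light cone in the normal bundle. For an isometric embedding $X:(\Sigma,\sigma)\to\mathbb R^{3,1}$ and $T_0$, put $\tau=-\langle X,T_0\rangle$; $|H_0|,\alpha_{H_0}$ are the corresponding data of the image of $X$ (with spacelike mean curvature vector $H_0$), and with $\nabla,\Delta$ of $\sigma$ $$\rho=\frac{\sqrt{|H_0|^2+\frac{(\Delta\tau)^2}{1+|\nabla\tau|^2}}-\sqrt{|H|^2+\frac{(\Delta\tau)^2}{1+|\nabla\tau|^2}}}{\sqrt{1+|\nabla\tau|^2}},$$ $$j^a=\sigma^{ac}\Big(\rho\,\partial_c\tau-\partial_c\Big[\sinh^{-1}\Big(\frac{\rho\Delta\tau}{|H_0||H|}\Big)\Big]-(\alpha_{H_0})_c+(\alpha_H)_c\Big).$$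 The quasi-local energy-momentum 4-vector is $p^\gamma=\frac1{8\pi}\int_\Sigma(\rho T_0^\gamma+(\nabla_aX^\gamma)j^a)\,d\Sigma$, and the quasi-local conserved quantities are $$\Phi^{\alpha\gamma}=-\frac1{16\pi}\int_\Sigma\Big[(X^\alpha T_0^\gamma-X^\gamma T_0^\alpha)\rho+(X^\alpha\nabla_aX^\gamma-X^\gamma\nabla_aX^\alpha)j^a\Big]d\Sigma,\qquad \alpha,\gamma=0,1,2,3.$$ Here $(X,T_0)$ need not satisfy any optimality equation. *)

(* Defs.v *)
From HB Require Import structures.
From mathcomp Require Import all_boot all_order all_algebra.
From mathcomp Require Import all_classical all_reals all_analysis.

Set Implicit Arguments.
Unset Strict Implicit.
Unset Printing Implicit Defensive.

Import Order.TTheory GRing.Theory Num.Theory.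
Import numFieldNormedType.Exports.

Local Open Scope classical_set_scope.
Local Open Scope ring_scope.

(** Calculus in coordinates *)

Section Calculus.
Context {R : realType}.

Definition partial m (V : normedModType R) (a : 'I_m) (f : 'rV[R]_m -> V)
  (x : 'rV[R]_m) : V := 'D_(delta_mx 0 a) f x.

Fixpoint Ck m (V : normedModType R) (k : nat) (U : set 'rV[R]_m)
    (f : 'rV[R]_m -> V) : Prop :=
  if k is k'.+1 then
    (forall x, U x -> differentiable f x) /\
    (forall a, Ck k' U (partial a f))
  else forall x, U x -> {for x, continuous f}.

(* Only used for open [U]. *)
Definition smooth_on m (V : normedModType R) (U : set 'rV[R]_m)
  (f : 'rV[R]_m -> V) : Prop := forall k, Ck k U f.

Definition bform n (G : 'M[R]_n) (u v : 'rV[R]_n) : R :=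
  (u *m G *m v^T) 0 0.

Definition christoffel n (G : 'rV[R]_n -> 'M[R]_n) (x : 'rV[R]_n)
    (k i j : 'I_n) : R :=
  2^-1 * \sum_l invmx (G x) k l *
    (partial i (fun y => G y j l) x + partial j (fun y => G y i l) x
     - partial l (fun y => G y i j) x).

(* The covariant derivative in the direction d/dx^a of a vector field [V]
   along the map [f], for the Levi-Civita connection of [G]. *)
Definition cov_along m n (G : 'rV[R]_n -> 'M[R]_n) (f V : 'rV[R]_m -> 'rV[R]_n)
    (a : 'I_m) (x : 'rV[R]_m) : 'rV[R]_n :=
  \row_k (partial a V x 0 k +
    \sum_i \sum_j christoffel G (f x) k i j * partial a f x 0 i * V x 0 j).

(* [S] is the matrix of the metric induced by [G] on the span of the [e a]. *)
Definition normal_part m n (S : 'M[R]_m) (G : 'M[R]_n) (e : 'I_m -> 'rV[R]_n)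
    (v : 'rV[R]_n) : 'rV[R]_n :=
  v - \sum_a \sum_b (invmx S a b * bform G v (e a)) *: e b.

(* H = sigma^{ab} (nabla_a d_b f)^perp, the trace of the second fundamental
   form (no factor 1/2; it points inwards for a round sphere). *)
Definition mean_curvature_local m n (S : 'rV[R]_m -> 'M[R]_m)
    (G : 'rV[R]_n -> 'M[R]_n) (f : 'rV[R]_m -> 'rV[R]_n) (x : 'rV[R]_m) :
    'rV[R]_n :=
  \sum_a \sum_b invmx (S x) a b *:
    normal_part (S x) (G (f x)) (fun c => partial c f x)
      (cov_along G f (partial b f) a x).

Definition arsinh (x : R) : R := ln (x + Num.sqrt (x ^+ 2 + 1)).

Lemma arsinhK (x : R) : (expR (arsinh x) - expR (- arsinh x)) / 2 = x.
Proof.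
have s0 : 0 <= x ^+ 2 + 1 by rewrite addr_ge0 ?sqr_ge0.
have xs : `|x| < Num.sqrt (x ^+ 2 + 1).
  by rewrite -sqrtr_sqr ltr_sqrt ?ltrDl// ltr_wpDl ?sqr_ge0.
have y0 : 0 < x + Num.sqrt (x ^+ 2 + 1).
  by rewrite -ltrBlDl sub0r (le_lt_trans _ xs)// -normrN ler_norm.
rewrite expRN /arsinh lnK ?posrE//.
have y1 : (x + Num.sqrt (x ^+ 2 + 1)) * (Num.sqrt (x ^+ 2 + 1) - x) = 1.
  by rewrite mulrC [x + _]addrC -subr_sqr sqr_sqrtr// addrC addKr.
have -> : (x + Num.sqrt (x ^+ 2 + 1))^-1 = Num.sqrt (x ^+ 2 + 1) - x.
  by apply: (mulfI (lt0r_neq0 y0)); rewrite divff ?lt0r_neq0// y1.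
by rewrite opprB addrACA subrr addr0 mulrDl -splitr.
Qed.

End Calculus.

(** Manifolds *)

Record chart (R : realType) (M : ptopologicalType) (n : nat) := Chart {
  dom : set M;
  cod : set 'rV[R]_n;
  coord : M -> 'rV[R]_n;
  para : 'rV[R]_n -> M;
  dom_open : open dom;
  cod_open : open cod;
  coordK : forall p, dom p -> cod (coord p) /\ para (coord p) = p;
  paraK : forall x, cod x -> dom (para x) /\ coord (para x) = x;
  coord_continuous : forall p, dom p -> {for p, continuous coord};
  para_continuous : forall x, cod x -> {for x, continuous para} }.

Definition transition (R : realType) (M : ptopologicalType) n
  (c c' : chart R M n) : 'rV[R]_n -> 'rV[R]_n := coord c' \o para c.

Record manifold (R : realType) (n : nat) := Manifold {
  carrier :> ptopologicalType;
  atlas : set (chart R carrier n);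
  manifold_hausdorff : hausdorff_space carrier;
  manifold_second_countable : @second_countable carrier;
  atlas_cover : forall p, exists2 c, atlas c & dom c p;
  atlas_smooth : forall c c', atlas c -> atlas c' ->
    smooth_on (coord c @` (dom c `&` dom c')) (transition c c') }.

Definition chart_at (R : realType) n (M : manifold R n) (p : M) :
  chart R M n := s2val (cid2 (atlas_cover p)).

(* A tensor field is given by its components in all charts of the atlas,
   subject to the transformation law.  Row vectors are used throughout, so
   that ['J f x a i] is the derivative of the i-th component of [f] in the
   direction d/dx^a. *)
Record metric (R : realType) n (M : manifold R n) := Metric {
  gcomp : chart R M n -> 'rV[R]_n -> 'M[R]_n;
  metric_smooth : forall c, atlas c -> smooth_on (cod c) (gcomp c);
  metric_sym : forall c x, atlas c -> cod c x -> (gcomp c x)^T = gcomp c x;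
  metric_law : forall c c' p, atlas c -> atlas c' -> dom c p -> dom c' p ->
    let J := jacobian (transition c c') (coord c p) in
    gcomp c (coord c p) = J *m gcomp c' (coord c' p) *m J^T }.

Definition riemannian (R : realType) n (M : manifold R n) (g : metric M) :=
  forall c x v, atlas c -> cod c x -> v != 0 -> 0 < bform (gcomp g c x) v v.

Record one_form (R : realType) n (M : manifold R n) := OneForm {
  ocomp : chart R M n -> M -> 'rV[R]_n;
  one_form_smooth : forall c, atlas c -> smooth_on (cod c) (ocomp c \o para c);
  one_form_law : forall c c' p, atlas c -> atlas c' -> dom c p -> dom c' p ->
    ocomp c p = ocomp c' p *m (jacobian (transition c c') (coord c p))^T }.

(** Spacetimes *)

Definition minkowski_form (R : realType) : 'M[R]_4 :=
  diag_mx (\row_i (if i == 0 then -1 else 1)).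

Record spacetime (R : realType) := Spacetime {
  events :> manifold R 4;
  smetric : metric events;
  spacetime_lorentzian : forall c x, atlas c -> cod c x ->
    exists2 P, P \in unitmx & P *m gcomp smetric c x *m P^T = minkowski_form R;
  (* a continuous timelike vector field, defining the time orientation *)
  tdir : chart R events 4 -> 'rV[R]_4 -> 'rV[R]_4;
  tdir_continuous : forall c x, atlas c -> cod c x ->
    {for x, continuous (tdir c)};
  tdir_timelike : forall c x, atlas c -> cod c x ->
    bform (gcomp smetric c x) (tdir c x) (tdir c x) < 0;
  tdir_law : forall c c' p, atlas c -> atlas c' -> dom c p -> dom c' p ->
    tdir c' (coord c' p) =
    tdir c (coord c p) *m jacobian (transition c c') (coord c p) }.

Definition future_null (R : realType) (N : spacetime R) (c : chart R N 4)
    (q : N) (v : 'rV[R]_4) : Prop :=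
  [/\ v != 0, bform (gcomp (smetric N) c (coord c q)) v v = 0 &
      bform (gcomp (smetric N) c (coord c q)) v (tdir c (coord c q)) < 0].

(** Minkowski space *)

Section Minkowski.
Context {R : realType}.

Lemma smooth_on_cst m (V : normedModType R) (U : set 'rV[R]_m) (v : V) :
  smooth_on U (fun=> v).
Proof.
move=> k; elim: k v => [|k IH] v /=; first by move=> x _; exact: cst_continuous.
split=> [x _|a]; first exact: differentiable_cst.
have -> : partial a (fun=> v) = (fun=> 0) :> ('rV[R]_m -> V).
  by apply/funext => x; rewrite /partial derive_cst.
exact: IH.
Qed.

Lemma smooth_on_id m (U : set 'rV[R]_m) : smooth_on U (id : 'rV[R]_m -> 'rV[R]_m).
Proof.
case=> [|k] /=; first by move=> x _; exact: cvg_id.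
split=> [x _|a]; first by case: (is_diff_id x).
have -> : partial a id = (fun=> delta_mx 0 a) :> ('rV[R]_m -> 'rV[R]_m).
  by apply/funext => x; rewrite /partial derive_id.
exact: smooth_on_cst.
Qed.

Lemma jacobian_id m (x : 'rV[R]_m) : jacobian (id : 'rV[R]_m -> 'rV[R]_m) x = 1%:M.
Proof.
apply/row_matrixP => i; rewrite !rowE -deriveEjacobian ?derive_id ?mulmx1//.
Qed.

Lemma rV_second_countable n : @second_countable 'rV[R]_n.
Proof.
pose B (qk : 'rV[rat]_n * nat) : set 'rV[R]_n :=
  (ball (map_mx ratr qk.1 : 'rV[R]_n) (qk.2.+1%:R^-1 : R))°.
exists (range B); first exact: (sub_countable (card_image_le _ _) (countableP _)).
split; first by move=> _ [qk _ <-]; exact: open_interior.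
move=> x V /nbhs_ballP[e /= e0 xeV].
have [k ke] : exists k, k.+1%:R^-1 < e / 2.
  have /= := @ltr_add_invr R 0 (e / 2); rewrite divr_gt0// => /(_ isT)[k].
  by rewrite add0r => ?; exists k.
have k0 : (0 : R) < k.+1%:R^-1 / 2 by rewrite divr_gt0// invr_gt0.
have k1 : (k.+1%:R^-1 / 2 : R) < k.+1%:R^-1.
  by rewrite ltr_pdivrMr ?ltr_pMr ?invr_gt0// ltr1n.
have qP i : exists q : rat, ball (x 0 i) (k.+1%:R^-1 / 2 : R) (ratr q).
  have [q] : exists q : rat, ratr q \in
      `]x 0 i - k.+1%:R^-1 / 2, x 0 i + k.+1%:R^-1 / 2[%R.
    by apply: rat_in_itvoo; rewrite ltrD2l (lt_trans _ k0)// oppr_lt0.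
  by rewrite in_itv/= -ltr_distlC => xq; exists q.
pose q : 'rV[rat]_n := \row_i sval (cid (qP i)).
have xq : ball x (k.+1%:R^-1 / 2 : R) (map_mx ratr q : 'rV[R]_n).
  split=> // i j; rewrite !mxE (ord1 i); exact: (svalP (cid (qP j))).
exists (B (q, k)); first split.
- by exists (q, k).
- rewrite /B/=; apply/nbhs_ballP; exists (k.+1%:R^-1 / 2) => //= y xy.
  by have := ball_triangle (ball_sym xq) xy; rewrite -splitr.
- move=> y /interior_subset qy; apply: xeV.
  rewrite [e]splitr; apply: (@ball_triangle _ _ (map_mx ratr q : 'rV[R]_n)).
    by apply: le_ball xq; exact/ltW/(lt_trans k1).
  by apply: le_ball qy; exact: ltW.
Qed.

Lemma std_chart_subproof n : forall x : 'rV[R]_n,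
  setT x -> setT (id x) /\ id (id x) = x.
Proof. by []. Qed.

Lemma std_chart_continuous n : forall x : 'rV[R]_n,
  setT x -> {for x, continuous (id : 'rV[R]_n -> 'rV[R]_n)}.
Proof. by move=> x _; exact: cvg_id. Qed.

Definition std_chart n : chart R 'rV[R]_n n :=
  @Chart R 'rV[R]_n n setT setT id id openT openT
    (@std_chart_subproof n) (@std_chart_subproof n)
    (@std_chart_continuous n) (@std_chart_continuous n).

Lemma std_cover n (p : 'rV[R]_n) :
  exists2 c, [set std_chart n] c & dom c p.
Proof. by exists (std_chart n). Qed.

Lemma std_smooth n (c c' : chart R 'rV[R]_n n) :
  [set std_chart n] c -> [set std_chart n] c' ->
  smooth_on (coord c @` (dom c `&` dom c')) (transition c c').
Proof. by move=> -> ->; exact: smooth_on_id. Qed.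

Definition std_manifold n : manifold R n :=
  @Manifold R n 'rV[R]_n [set std_chart n] (@norm_hausdorff _ _)
    (@rV_second_countable n) (@std_cover n) (@std_smooth n).

Lemma minkowski_sym (c : chart R (std_manifold 4) 4) (x : 'rV[R]_4) :
  atlas c -> cod c x -> (minkowski_form R)^T = minkowski_form R.
Proof. by move=> _ _; rewrite /minkowski_form tr_diag_mx. Qed.

Lemma minkowski_law (c c' : chart R (std_manifold 4) 4) (p : std_manifold 4) :
  atlas c -> atlas c' -> dom c p -> dom c' p ->
  let J := jacobian (transition c c') (coord c p) in
  minkowski_form R = J *m minkowski_form R *m J^T.
Proof.
by move=> -> -> _ _ J; rewrite /J jacobian_id trmx1 mulmx1 mul1mx.
Qed.

Definition minkowski_metric : metric (std_manifold 4) :=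
  @Metric R 4 (std_manifold 4) (fun _ _ => minkowski_form R)
    (fun c _ => @smooth_on_cst _ _ (cod c) (minkowski_form R))
    minkowski_sym minkowski_law.

Lemma minkowski_lorentzian (c : chart R (std_manifold 4) 4) (x : 'rV[R]_4) :
  atlas c -> cod c x ->
  exists2 P, P \in unitmx &
    P *m gcomp minkowski_metric c x *m P^T = minkowski_form R.
Proof.
by move=> _ _; exists 1%:M; rewrite ?unitmx1// trmx1 mulmx1 mul1mx.
Qed.

Lemma minkowski_tdir_continuous (c : chart R (std_manifold 4) 4)
    (x : 'rV[R]_4) : atlas c -> cod c x ->
  {for x, continuous (fun=> delta_mx 0 0 : 'rV[R]_4)}.
Proof. by move=> _ _; exact: cst_continuous. Qed.

Lemma minkowski_tdir_timelike (c : chart R (std_manifold 4) 4)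
    (x : 'rV[R]_4) : atlas c -> cod c x ->
  bform (gcomp minkowski_metric c x) (delta_mx 0 0) (delta_mx 0 0) < 0.
Proof.
move=> _ _; rewrite /bform /= /minkowski_form trmx_delta.
by rewrite mul_mx_diag -colE !mxE !eqxx mul1r oppr_lt0 ltr01.
Qed.

Lemma minkowski_tdir_law (c c' : chart R (std_manifold 4) 4)
    (p : std_manifold 4) :
  atlas c -> atlas c' -> dom c p -> dom c' p ->
  delta_mx 0 0 =
  (delta_mx 0 0 : 'rV[R]_4) *m jacobian (transition c c') (coord c p).
Proof. by move=> -> -> _ _; rewrite jacobian_id mulmx1. Qed.

(* Minkowski space with its standard coordinates x^0, ..., x^3, time-oriented
   by d/dx^0. *)
Definition minkowski_space : spacetime R :=
  @Spacetime R (std_manifold 4) minkowski_metric minkowski_lorentzian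
    (fun _ _ => delta_mx 0 0) minkowski_tdir_continuous
    minkowski_tdir_timelike minkowski_tdir_law.

End Minkowski.
Arguments minkowski_space R : clear implicits.

(** Surfaces in a spacetime and their extrinsic geometry *)

Section Surface.
Context {R : realType}.
Variables (S : manifold R 2) (sigma : metric S).

Section Embedding.
Variables (N : spacetime R) (F : S -> N).

Definition local_rep (d : chart R S 2) (c : chart R N 4) :
  'rV[R]_2 -> 'rV[R]_4 := coord c \o F \o para d.

Definition overlap (d : chart R S 2) (c : chart R N 4) : set 'rV[R]_2 :=
  [set x | cod d x /\ dom c (F (para d x))].

Definition smooth_map : Prop :=
  continuous F /\ forall d c, atlas d -> atlas c ->
    smooth_on (overlap d c) (local_rep d c).

(* When [sigma] is Riemannian, [F] is automatically an immersion and its image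
   is spacelike; when moreover [S] is compact, [F] is a topological embedding. *)
Definition isometric_embedding : Prop :=
  [/\ injective F, smooth_map & forall d c x, atlas d -> atlas c ->
    overlap d c x ->
    let J := jacobian (local_rep d c) x in
    gcomp sigma d x = J *m gcomp (smetric N) c (local_rep d c x) *m J^T].

(* Sections of the pull-back of the tangent bundle of [N] by [F]. *)
Record vfield_along := VFieldAlong {
  vcomp : chart R N 4 -> S -> 'rV[R]_4;
  vfield_smooth : forall d c, atlas d -> atlas c ->
    smooth_on (overlap d c) (vcomp c \o para d);
  vfield_law : forall c c' p, atlas c -> atlas c' ->
    dom c (F p) -> dom c' (F p) ->
    vcomp c' p = vcomp c p *m jacobian (transition c c') (coord c (F p)) }.

Definition form_at (c : chart R N 4) (p : S) : 'rV[R]_4 -> 'rV[R]_4 -> R :=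
  bform (gcomp (smetric N) c (coord c (F p))).

Definition inner (V W : vfield_along) (p : S) : R :=
  let c := chart_at (F p) in form_at c p (vcomp V c p) (vcomp W c p).

Definition normal_at (d : chart R S 2) (c : chart R N 4) (p : S)
  (v : 'rV[R]_4) : Prop :=
  forall a, form_at c p v (partial a (local_rep d c) (coord d p)) = 0.

Definition is_mean_curvature (H : vfield_along) : Prop :=
  forall d c p, atlas d -> atlas c -> dom d p -> dom c (F p) ->
  vcomp H c p = mean_curvature_local (gcomp sigma d) (gcomp (smetric N) c)
                  (local_rep d c) (coord d p).

(* The light cone of the normal plane consists of two null lines.  The
   incoming one is spanned by the future null normal [l] with <l, H> > 0, i.e.
   along which the area decreases, and the outgoing one by the future null
   normal [k] with <k, H> < 0.  The reflection through the incoming line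
   fixes [l] and sends [k] to [- k]. *)
Definition is_reflection (H J : vfield_along) : Prop :=
  forall d c p, atlas d -> atlas c -> dom d p -> dom c (F p) ->
  exists l k (a b : R),
    [/\ normal_at d c p l /\ normal_at d c p k,
        future_null c (F p) l /\ future_null c (F p) k,
        0 < form_at c p l (vcomp H c p) /\ form_at c p k (vcomp H c p) < 0,
        vcomp H c p = a *: l + b *: k &
        vcomp J c p = a *: l - b *: k].

(* alpha_H(d/dx^a) = < nabla^N_a (J/|H|), H/|H| > *)
Definition is_connection_form (H J : vfield_along) (alpha : one_form S) :=
  forall d c p a, atlas d -> atlas c -> dom d p -> dom c (F p) ->
  let h q := Num.sqrt (inner H H q) in
  ocomp alpha d p 0 a =
    form_at c p
      (cov_along (gcomp (smetric N) c) (local_rep d c)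
        (fun x => (h (para d x))^-1 *: vcomp J c (para d x)) a (coord d p))
      ((h p)^-1 *: vcomp H c p).

Record extrinsic_data := ExtrinsicData {
  mcv : vfield_along;
  mcv_refl : vfield_along;
  alphaH : one_form S;
  mcvP : is_mean_curvature mcv;
  mcv_spacelike : forall p, 0 < inner mcv mcv p;
  mcv_reflP : is_reflection mcv mcv_refl;
  alphaHP : is_connection_form mcv mcv_refl alphaH }.

Definition mc_norm (E : extrinsic_data) (p : S) : R :=
  Num.sqrt (inner (mcv E) (mcv E) p).

End Embedding.

(** Intrinsic calculus on the surface.  Quantities independent of the chart
    are computed at [p] in the chart [chart_at p]. *)

Definition pd (d : chart R S 2) (f : S -> R) (a : 'I_2) (p : S) : R :=
  partial a (f \o para d) (coord d p).

Definition sigma_inv (d : chart R S 2) (p : S) : 'M[R]_2 :=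
  invmx (gcomp sigma d (coord d p)).

Definition grad_sq (f : S -> R) (p : S) : R :=
  let d := chart_at p in
  \sum_a \sum_b sigma_inv d p a b * pd d f a p * pd d f b p.

Definition laplacian (f : S -> R) (p : S) : R :=
  let d := chart_at p in
  \sum_a \sum_b sigma_inv d p a b *
    (partial a (partial b (f \o para d)) (coord d p) -
     \sum_c christoffel (gcomp sigma d) (coord d p) c a b * pd d f c p).

Definition borel_surface := g_sigma_algebraType (@open S).

Definition rV2 (x : R * R) : 'rV[R]_2 := \row_i (if i == 0 then x.1 else x.2).

Definition is_area_measure (mu : {measure set borel_surface -> \bar R}) :=
  forall d (A : set borel_surface), atlas d -> measurable A -> A `<=` dom d ->
  mu A = (\int[(@lebesgue_measure R \x @lebesgue_measure R)]_(x in
            [set x | (coord d @` A) (rV2 x)])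
            (Num.sqrt (\det (gcomp sigma d (rV2 x))))%:E)%E.

(** Quasi-local quantities *)

Section Quasilocal.
Variables (N : spacetime R) (F : S -> N) (E : extrinsic_data F).
Variables (X : S -> minkowski_space R) (E0 : extrinsic_data X).
Variables (T0 : 'rV[R]_4) (mu : {measure set borel_surface -> \bar R}).

Definition position (g : 'I_4) (p : S) : R := (X p : 'rV[R]_4) 0 g.

Definition tau (p : S) : R := - bform (minkowski_form R) (X p) T0.

Definition rho (p : S) : R :=
  let w := (laplacian tau p) ^+ 2 / (1 + grad_sq tau p) in
  (Num.sqrt ((mc_norm E0 p) ^+ 2 + w) - Num.sqrt ((mc_norm E p) ^+ 2 + w))
  / Num.sqrt (1 + grad_sq tau p).

(* The components j^a in the chart [d]. *)
Definition current (d : chart R S 2) (p : S) (a : 'I_2) : R :=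
  \sum_c sigma_inv d p a c *
    (rho p * pd d tau c p
     - pd d (fun q => arsinh (rho q * laplacian tau q /
                              (mc_norm E0 q * mc_norm E q))) c p
     - ocomp (alphaH E0) d p 0 c
     + ocomp (alphaH E) d p 0 c).

(* (nabla_a X^g) j^a *)
Definition current_deriv (g : 'I_4) (p : S) : R :=
  let d := chart_at p in \sum_a pd d (position g) a p * current d p a.

Definition energy_momentum (g : 'I_4) : R :=
  (8 * pi)^-1 * \int[mu]_p (rho p * T0 0 g + current_deriv g p).

Definition conserved_quantity (al g : 'I_4) : R :=
  - (16 * pi)^-1 * \int[mu]_p
    ((position al p * T0 0 g - position g p * T0 0 al) * rho p +
     (position al p * current_deriv g p - position g p * current_deriv al p)).

End Quasilocal.

End Surface.

Arguments energy_momentum {R S} sigma {N F} E {X} E0 T0 mu g.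
Arguments conserved_quantity {R S} sigma {N F} E {X} E0 T0 mu al g.

(* Main.v *)
(** The translation changes neither the first derivatives of X and tau nor the
    mean curvature vector, and the mean curvature vector determines its
    reflection through the incoming light cone.  Hence rho and j are those of X,
    and the density of Phi' is that of Phi plus b^alpha times the density of
    p^gamma minus b^gamma times the density of p^alpha.

    Splitting the integral requires these densities to be integrable: they are
    continuous and Sigma is compact with finite area.  They are defined pointwise
    in an arbitrarily chosen chart, so continuity rests on their independence of
    the chart.  For the Laplacian of tau this is read off the Gauss formula
    Laplacian X = H_0, since H_0 is a globally defined smooth field; it also
    gives the regularity of rho needed to differentiate the arsinh term. *)
Require Import Defs.
From HB Require Import structures.
From mathcomp Require Import all_boot all_order all_algebra.
From mathcomp Require Import all_classical all_reals all_analysis.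
From mathcomp Require Import ring lra.
Import Order.TTheory GRing.Theory Num.Theory.
Import numFieldNormedType.Exports.
Set Implicit Arguments.
Unset Strict Implicit.
Unset Printing Implicit Defensive.
Local Open Scope classical_set_scope.
Local Open Scope ring_scope.

(* The unqualified name denotes the coordinates of a vector in a basis. *)
Local Notation coord := Defs.coord.

(** [E0] and [E0'] are given independently, so nothing identifies their fields in advance. The null
    vectors that witness [is_reflection] are chosen anew at each point and are free up to scale;
    this forces a comparison of null frames in the normal plane.

    The class [C1_at] is used instead of [smooth_on] because it passes easily through roots,
    quotients and logarithms. It is enough: the arsinh term is differentiated once, the result need
    only be continuous, and the second derivatives in [laplacian] disappear into a component of
    [mcv E0], smooth by its type.

    The area measure is specified only on Borel sets inside one chart domain, so finiteness of the
    total area has to be assembled from local bounds. The factor 1/2 in the conclusion is the ratio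
    of the normalisations 1/(16 pi) and 1/(8 pi). *)

Lemma near_eq_differentiable (R : numFieldType) (V W : normedModType R)
    (f g : V -> W) (x : V) :
  (\forall y \near x, f y = g y) -> differentiable f x -> differentiable g x.
Proof.
move=> fg df.
(* [g] is [f] plus a function that vanishes near [x], and the latter has differential zero. *)
suff dr : differentiable (g \- f) x.
  have -> : g = f + (g \- f) by apply/funext => y; rewrite /= /GRing.add_fun/= addrC subrK.
  exact: differentiableD.
have E : (g \- f) \o shift x = cst ((g \- f) x) + (0 : V -> W) +o_ 0 id.
  apply/eqaddoP => e e0.
  rewrite near_simpl; have := fg; rewrite (near_shift 0) subr0 => fg0.
  near=> h; rewrite /= fctE/= (nbhs_singleton fg) !subrr addr0 subr0.
  rewrite (_ : f (h + x) = g (h + x)); last by near: h.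
  by rewrite subrr normr0 mulr_ge0 // ltW.
have d0 : 'd (g \- f) x = (0 : V -> W) :> (V -> W).
  by apply: diff_unique => //; exact: cst_continuous.
by apply/diff_locallyP; split; rewrite d0//; exact: cst_continuous.
Unshelve. all: by end_near. Qed.

Lemma continuous_sum (R : realType) (T : topologicalType) (I : Type)
    (r : seq I) (P : pred I) (F : I -> T -> R) (x : T) :
  (forall i, P i -> {for x, continuous (F i)}) ->
  {for x, continuous (fun y => \sum_(i <- r | P i) F i y)}.
Proof.
move=> cF; elim: r => [|i r IH].
  have -> : (fun y => \sum_(i <- [::] | P i) F i y) = cst 0.
    by apply/funext => y; rewrite big_nil.
  exact: cst_continuous.
have -> : (fun y => \sum_(j <- i :: r | P j) F j y) =
    (fun y => if P i then F i y + \sum_(j <- r | P j) F j y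
              else \sum_(j <- r | P j) F j y).
  by apply/funext => y; rewrite big_cons.
case: (P i) (cF i) => // cFi; apply: continuousD; last exact: IH.
exact: cFi.
Qed.

(** * Functions of class C^1 at a point of R^m *)

Section C1.
Context {R : realType}.

(** Differentiability is required near [x], so that product and chain rules hold for germs;
    continuity of the partial derivatives is required only at [x], which is all that these rules
    reproduce. *)
Definition C1_at m (f : 'rV[R]_m -> R) (x : 'rV[R]_m) : Prop :=
  (\forall y \near x, differentiable f y) /\
  forall a, {for x, continuous (partial a f)}.

Section Germs.
Variable m : nat.
Implicit Types (f g : 'rV[R]_m -> R) (x : 'rV[R]_m).

Lemma near_eq_partial (V : normedModType R) (f g : 'rV[R]_m -> V) a x :
  (\forall y \near x, f y = g y) -> partial a f x = partial a g x.
Proof. exact: near_eq_derive. Qed.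

Lemma near_eq_continuous (T U : topologicalType) (f g : T -> U) (x : T) :
  (\forall y \near x, f y = g y) -> {for x, continuous f} -> {for x, continuous g}.
Proof.
move=> fg fx; have fx' : f @ x --> g x by rewrite -(nbhs_singleton fg); exact: fx.
suff : g @ x --> g x by [].
by apply: cvg_trans fx'; exact: near_eq_cvg.
Qed.

Lemma near_eq_C1 f g x : (\forall y \near x, f y = g y) -> C1_at f x -> C1_at g x.
Proof.
move=> fg [df cf]; have fg2 := near_join fg; split.
  near=> y; apply: (@near_eq_differentiable _ _ _ f); last by near: y.
  by near: y.
move=> a; apply: near_eq_continuous (cf a).
by near=> y; apply: near_eq_partial; near: y.
Unshelve. all: by end_near. Qed.

Lemma C1_differentiable f x : C1_at f x -> differentiable f x.
Proof. by move=> [/nbhs_singleton]. Qed.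

Lemma C1_continuous f x : C1_at f x -> {for x, continuous f}.
Proof. by move=> /C1_differentiable; exact: differentiable_continuous. Qed.

Lemma C1_partial f x a : C1_at f x -> {for x, continuous (partial a f)}.
Proof. by move=> [_]. Qed.

Lemma C1_cst (k : R) x : C1_at (fun=> k) x.
Proof.
split; first by near=> y; exact: differentiable_cst.
move=> a; have -> : partial a (fun=> k) = (fun=> 0) :> ('rV[R]_m -> R).
  by apply/funext => y; rewrite /partial derive_cst.
exact: cst_continuous.
Unshelve. all: by end_near. Qed.

Lemma partialD (V : normedModType R) (f g : 'rV[R]_m -> V) a x :
  differentiable f x -> differentiable g x ->
  partial a (fun y => f y + g y) x = partial a f x + partial a g x.
Proof. by move=> df dg; rewrite /partial -deriveD//; exact: diff_derivable. Qed.

Lemma partialM f g a x : differentiable f x -> differentiable g x ->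
  partial a (fun y => f y * g y) x = f x * partial a g x + g x * partial a f x.
Proof. by move=> df dg; rewrite /partial -deriveM//; exact: diff_derivable. Qed.

Lemma C1D f g x : C1_at f x -> C1_at g x -> C1_at (fun y => f y + g y) x.
Proof.
move=> [df cf] [dg cg]; split.
  by near=> y; apply: differentiableD; near: y.
move=> a; apply: (@near_eq_continuous _ _ (fun y => partial a f y + partial a g y)).
  by near=> y; rewrite partialD//; near: y.
by apply: continuousD; [exact: cf|exact: cg].
Unshelve. all: by end_near. Qed.

Lemma C1M f g x : C1_at f x -> C1_at g x -> C1_at (fun y => f y * g y) x.
Proof.
move=> cf cg; have [df pf] := cf; have [dg pg] := cg; split.
  by near=> y; apply: differentiableM; near: y.
move=> a; apply: (@near_eq_continuous _ _
    (fun y => f y * partial a g y + g y * partial a f y)).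
  by near=> y; rewrite partialM//; near: y.
have := continuousD (continuousM (C1_continuous cf) (pg a))
  (continuousM (C1_continuous cg) (pf a)).
exact.
Unshelve. all: by end_near. Qed.

Lemma C1N f x : C1_at f x -> C1_at (fun y => - f y) x.
Proof.
move=> cf; apply: near_eq_C1 (C1M (C1_cst (-1) x) cf).
by near=> y; rewrite mulN1r.
Unshelve. all: by end_near. Qed.

Lemma C1B f g x : C1_at f x -> C1_at g x -> C1_at (fun y => f y - g y) x.
Proof. by move=> cf cg; apply: C1D => //; exact: C1N. Qed.

Lemma C1X f n x : C1_at f x -> C1_at (fun y => f y ^+ n) x.
Proof.
move=> cf; elim: n => [|n IH]; first exact: C1_cst.
by apply: near_eq_C1 (C1M cf IH); near=> y; rewrite exprS.
Unshelve. all: by end_near. Qed.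

Lemma C1_sum (I : Type) (r : seq I) (P : pred I) (F : I -> 'rV[R]_m -> R) x :
  (forall i, P i -> C1_at (F i) x) -> C1_at (fun y => \sum_(i <- r | P i) F i y) x.
Proof.
move=> cF; elim: r => [|i r IH].
  by apply: near_eq_C1 (C1_cst 0 x); near=> y; rewrite big_nil.
have [Pi|nPi] := boolP (P i).
  apply: near_eq_C1 (C1D (cF i Pi) IH).
  by near=> y; rewrite big_cons Pi.
by apply: near_eq_C1 IH; near=> y; rewrite big_cons (negbTE nPi).
Unshelve. all: by end_near. Qed.

Lemma partial_comp1 (phi dphi : R -> R) f a x :
  is_derive (f x) 1 phi (dphi (f x)) -> differentiable f x ->
  partial a (phi \o f) x = dphi (f x) * partial a f x.
Proof.
move=> dp df; have dphi' : differentiable phi (f x).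
  by apply/derivable1_diffP; case: dp.
rewrite /partial deriveE; last exact: differentiable_comp.
rewrite diff_comp//= -(deriveE _ df) -[X in 'd phi _ X]mulr1 [LHS]linearZ/=.
by case: dp => _ <-; rewrite [X in _ = X * _]deriveE// mulrC.
Qed.

(** The derivative [dphi] is an explicit argument: for the inverse, the square root and [ln] it has
    a closed form, valid near [f x] but not at the singularity. *)
Lemma C1_comp1 (phi dphi : R -> R) f x :
  (\forall t \near f x, is_derive (t : R) 1 phi (dphi t)) ->
  {for f x, continuous dphi} -> C1_at f x -> C1_at (phi \o f) x.
Proof.
move=> dp cp cf; have [df pf] := cf; have fc := C1_continuous cf.
have dp' : \forall y \near x, is_derive (f y) 1 phi (dphi (f y)) by exact: fc _ dp.
split.
  near=> y; apply: differentiable_comp; first by near: y.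
  have : is_derive (f y) 1 phi (dphi (f y)) by near: y.
  by case=> + _ => /derivable1_diffP.
move=> a; apply: (@near_eq_continuous _ _ (fun y => dphi (f y) * partial a f y)).
  by near=> y; apply/esym/partial_comp1; near: y.
by apply: continuousM; [exact: continuous_comp|exact: pf].
Unshelve. all: by end_near. Qed.

Lemma C1V f x : f x != 0 -> C1_at f x -> C1_at (fun y => (f y)^-1) x.
Proof.
move=> fx0 cf; apply: (@C1_comp1 (fun t => t^-1) (fun t => - (t ^- 2))) => //.
  have : nbhs (f x) [set t : R | t != 0].
    by apply: open_nbhs_nbhs; split => //; exact: open_neq.
  apply: filterS => t /= t0.
  apply: is_derive_eq; first exact: is_deriveV.
  by rewrite scaleNr -[_ *: 1]/(_ * 1) mulr1.
apply: continuousN; apply: continuousV; first by rewrite expf_neq0.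
exact: exprn_continuous.
Qed.

Lemma C1_sqrt f x : 0 < f x -> C1_at f x -> C1_at (fun y => Num.sqrt (f y)) x.
Proof.
move=> fx0 cf; apply: (@C1_comp1 Num.sqrt (fun t => (2 * Num.sqrt t)^-1)) => //.
  have : nbhs (f x) [set t | 0 < t] by exact: lt_nbhsr.
  by apply: filterS => t t0; exact: is_derive1_sqrt.
apply: continuousV; first by rewrite mulf_neq0// gt_eqF// sqrtr_gt0.
by apply: continuousM; [exact: cst_continuous|exact: sqrt_continuous].
Qed.

Lemma C1_ln f x : 0 < f x -> C1_at f x -> C1_at (fun y => ln (f y)) x.
Proof.
move=> fx0 cf; apply: (@C1_comp1 (@ln R) (fun t => t^-1)) => //.
  have : nbhs (f x) [set t | 0 < t] by exact: lt_nbhsr.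
  by apply: filterS => t t0; exact: is_derive1_ln.
by apply: continuousV; [rewrite gt_eqF|exact: cvg_id].
Qed.

Lemma C1_arsinh f x : C1_at f x -> C1_at (fun y => arsinh (f y)) x.
Proof.
move=> cf; have s0 : 0 < f x ^+ 2 + 1 by rewrite ltr_wpDl ?sqr_ge0.
apply: C1_ln; last first.
  by apply: C1D => //; apply: C1_sqrt => //; apply: C1D (C1_cst _ _); exact: C1X.
rewrite -ltrBlDl sub0r (@le_lt_trans _ _ `|f x|)//.
  by rewrite -normrN ler_norm.
by rewrite -sqrtr_sqr ltr_sqrt// ltrDl.
Qed.

End Germs.

Lemma partial_comp m n (h : 'rV[R]_m -> 'rV[R]_n) (V : normedModType R)
    (g : 'rV[R]_n -> V) a x :
  differentiable h x -> differentiable g (h x) ->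
  partial a (g \o h) x = \sum_i partial a h x 0 i *: partial i g (h x).
Proof.
move=> dh dg; rewrite /partial deriveE; last exact: differentiable_comp.
rewrite diff_comp//= -(deriveE _ dh).
rewrite [X in 'd g _ X]row_sum_delta linear_sum/=.
by apply: eq_bigr => i _; rewrite linearZ/= -deriveE.
Qed.

Lemma differentiable_entry m p q (f : 'rV[R]_m -> 'M[R]_(p, q)) i j x :
  differentiable f x -> differentiable (fun y => f y i j) x.
Proof.
move=> df; apply: (@differentiable_comp _ _ _ _ f (fun M : 'M[R]_(p, q) => M i j)) => //.
exact: differentiable_coord.
Qed.

Lemma partial_entry m p q (f : 'rV[R]_m -> 'M[R]_(p, q)) i j a x :
  differentiable f x -> partial a f x i j = partial a (fun y => f y i j) x.
Proof.
by move=> df; rewrite /partial derive_mx ?mxE//; exact: diff_derivable.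
Qed.

Lemma C1_comp m n (h : 'rV[R]_m -> 'rV[R]_n) (g : 'rV[R]_n -> R) x :
  (\forall y \near x, differentiable h y) -> (forall i, C1_at (fun y => h y 0 i) x) ->
  C1_at g (h x) -> C1_at (g \o h) x.
Proof.
move=> dh ch cg; have [dg pg] := cg.
have hc : {for x, continuous h}.
  by apply: differentiable_continuous; apply: (nbhs_singleton dh).
have dg' : \forall y \near x, differentiable g (h y) by exact: hc _ dg.
split; first by near=> y; apply: differentiable_comp; near: y.
move=> a; apply: (@near_eq_continuous _ _
   (fun y => \sum_i partial a (fun z => h z 0 i) y * partial i g (h y))).
  near=> y; have dhy : differentiable h y by near: y.
  rewrite partial_comp//; last by near: y.
  by apply: eq_bigr => i _; rewrite partial_entry.
apply: continuous_sum => i _.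
have pgh : {for x, continuous (partial i g \o h)}.
  by apply: continuous_comp => //; exact: pg.
exact: (continuousM (C1_partial (a:=a) (ch i)) pgh).
Unshelve. all: by end_near. Qed.

(** Agreement on an open set passes to the partial derivatives, hence through the recursion of
    [Ck]. *)
Lemma Ck_eq m (V : normedModType R) k (U : set 'rV[R]_m) (f g : 'rV[R]_m -> V) :
  open U -> (forall x, U x -> f x = g x) -> Ck k U f -> Ck k U g.
Proof.
move=> oU; elim: k f g => [|k IH] f g fg /=.
  move=> cf x Ux; apply: near_eq_continuous (cf x Ux).
  by apply: filterS (open_nbhs_nbhs (conj oU Ux)).
have nfg x : U x -> \forall y \near x, f y = g y.
  by move=> Ux; apply: filterS (open_nbhs_nbhs (conj oU Ux)).
move=> [df cf]; split=> [x Ux|a].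
  exact: near_eq_differentiable (nfg x Ux) (df x Ux).
apply: IH (cf a) => x Ux; exact/near_eq_partial/nfg.
Qed.

Lemma Ck_entry m p q k (U : set 'rV[R]_m) (f : 'rV[R]_m -> 'M[R]_(p, q)) i j :
  open U -> Ck k U f -> Ck k U (fun y => f y i j).
Proof.
move=> oU; elim: k f => [|k IH] f /=.
  move=> cf x Ux; apply: (@continuous_comp _ _ _ f (fun M : 'M[R]_(p, q) => M i j)).
    exact: cf.
  exact: coord_continuous.
move=> [df cf]; split=> [x Ux|a]; first exact/differentiable_entry/df.
apply: Ck_eq (IH _ (cf a)) => // x Ux; exact/partial_entry/df.
Qed.

Lemma smooth_entry m p q (U : set 'rV[R]_m) (f : 'rV[R]_m -> 'M[R]_(p, q)) i j :
  open U -> smooth_on U f -> smooth_on U (fun y => f y i j).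
Proof. by move=> oU sf k; exact: Ck_entry. Qed.

Lemma smooth_partial m (V : normedModType R) (U : set 'rV[R]_m) (f : 'rV[R]_m -> V) a :
  smooth_on U f -> smooth_on U (partial a f).
Proof. by move=> sf k; have [_ /(_ a)] := sf k.+1. Qed.

Lemma smooth_differentiable m (V : normedModType R) (U : set 'rV[R]_m)
    (f : 'rV[R]_m -> V) x : smooth_on U f -> U x -> differentiable f x.
Proof. by move=> /(_ 1%N)[df _]; exact: df. Qed.

Lemma smooth_differentiable_near m (V : normedModType R) (U : set 'rV[R]_m)
    (f : 'rV[R]_m -> V) x : open U -> smooth_on U f -> U x ->
  \forall y \near x, differentiable f y.
Proof.
move=> oU sf Ux; apply: filterS (open_nbhs_nbhs (conj oU Ux)) => y.
exact: smooth_differentiable.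
Qed.

Lemma smooth_C1 m (U : set 'rV[R]_m) (f : 'rV[R]_m -> R) x :
  open U -> smooth_on U f -> U x -> C1_at f x.
Proof.
move=> oU sf Ux; split; first exact: smooth_differentiable_near sf Ux.
by move=> a; have [_ /(_ a)] := sf 1%N; apply.
Qed.

Lemma smooth_C1_entry m p q (U : set 'rV[R]_m) (f : 'rV[R]_m -> 'M[R]_(p, q)) i j x :
  open U -> smooth_on U f -> U x -> C1_at (fun y => f y i j) x.
Proof. by move=> oU sf; exact/smooth_C1/smooth_entry. Qed.

End C1.

(** * Symmetry of second derivatives *)

Section Schwarz.
Context {R : realType} {V : normedModType R}.
Implicit Types (f : V -> R) (x u v : V).

Lemma is_derive_line f x v (t : R) : differentiable f (x + t *: v) ->
  is_derive t (1 : R) (fun s : R => f (x + s *: v)) ('D_v f (x + t *: v)).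
Proof.
move=> df; have dl : is_diff t (fun s : R => x + s *: v) (fun s : R => s *: v).
  apply: is_diff_eq; rewrite add0r//.
have dfl : differentiable (fun s : R => f (x + s *: v)) t.
  by apply: (@differentiable_comp _ _ _ _ (fun s : R => x + s *: v) f) => //; case: dl.
split; first exact/derivable1_diffP.
rewrite deriveE// (@diff_comp _ _ _ _ (fun s : R => x + s *: v) f)//.
by rewrite /= diff_val scale1r -deriveE.
Qed.

(** The mean value theorem is applied along [u] and then along [v]; differentiability on the whole
    parallelogram serves both uses. *)
Lemma second_difference f x u v (h : R) : 0 < h ->
  (forall s t, 0 <= s <= h -> 0 <= t <= h ->
    differentiable f (x + s *: u + t *: v) /\
    differentiable ('D_u f) (x + s *: u + t *: v)) ->
  exists s t, [/\ 0 <= s <= h, 0 <= t <= h &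
    f (x + h *: u + h *: v) - f (x + h *: u) - (f (x + h *: v) - f x) =
    h * h * 'D_v ('D_u f) (x + s *: u + t *: v)].
Proof.
move=> h0 df.
have hh : 0 <= h <= h by rewrite ltW/=.
have h00 : (0 : R) <= 0 <= h by rewrite lexx ltW.
have oo_cc (s : R) : s \in `]0, h[%R -> 0 <= s <= h.
  by rewrite in_itv/= => /andP[/ltW-> /ltW->].
(* The second difference is the increment of [phi] over [0, h]. *)
pose phi s := f (x + h *: v + s *: u) - f (x + s *: u).
have dphi (s : R) : 0 <= s <= h -> is_derive s (1 : R) phi
    ('D_u f (x + h *: v + s *: u) - 'D_u f (x + s *: u)).
  move=> sh; apply: is_deriveB; apply: is_derive_line.
    by rewrite addrAC; case: (df s h).
  by have [] := df s 0 sh h00; rewrite scale0r addr0.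
have cphi : {within `[0, h], continuous phi}.
  apply: continuous_in_subspaceT => s; rewrite inE/= in_itv/= => sh.
  by apply: differentiable_continuous; apply/derivable1_diffP; case: (dphi s sh).
have [s] := MVT h0 (fun s sh => dphi s (oo_cc _ sh)) cphi.
rewrite in_itv/= subr0 => /andP[/ltW s0 /ltW sh] Es.
have s0h : 0 <= s <= h by rewrite s0.
(* By the first mean value step, the second difference is [h] times the increment of [psi] over
   [0, h]. *)
pose psi t := 'D_u f (x + s *: u + t *: v).
have dpsi (t : R) : 0 <= t <= h -> is_derive t (1 : R) psi
    ('D_v ('D_u f) (x + s *: u + t *: v)).
  by move=> th; apply: is_derive_line; case: (df s t).
have cpsi : {within `[0, h], continuous psi}.
  apply: continuous_in_subspaceT => t; rewrite inE/= in_itv/= => th.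
  by apply: differentiable_continuous; apply/derivable1_diffP; case: (dpsi t th).
have [t] := MVT h0 (fun s sh => dpsi s (oo_cc _ sh)) cpsi.
rewrite in_itv/= subr0 => /andP[/ltW t0 /ltW th] Et.
exists s, t; split=> //; first by rewrite t0.
move: Es Et; rewrite /phi /psi !scale0r !addr0 => Es Et.
rewrite -mulrA [h * (_ * _)]mulrC [h * _]mulrC -Et.
rewrite ![x + s *: u + _]addrAC -Es [x + h *: u + _]addrAC; ring.
Qed.

(** The second difference is symmetric in [u] and [v], so the two mixed derivatives take a common
    value at points of a small parallelogram; continuity at [x] does the rest. *)
Lemma schwarz f x u v :
  (\forall y \near x, [/\ differentiable f y, differentiable ('D_u f) y &
                          differentiable ('D_v f) y]) ->
  {for x, continuous ('D_v ('D_u f))} -> {for x, continuous ('D_u ('D_v f))} ->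
  'D_v ('D_u f) x = 'D_u ('D_v f) x.
Proof.
move=> df cvu cuv; apply/eqP; rewrite -subr_eq0 -normr_le0; apply/ler_addgt0Pl => e e0.
have e2 : 0 < e / 2 by rewrite divr_gt0.
have dist_half (A B Q : R) : `|A - Q| < e / 2 -> `|B - Q| < e / 2 -> `|A - B| <= e.
  move=> AQ BQ; rewrite -(subrKA Q) (le_trans (ler_normD _ _))//.
  by rewrite [`|Q - B|]distrC; lra.
have nvu : \forall y \near x, `|'D_v ('D_u f) x - 'D_v ('D_u f) y| < e / 2.
  exact: ((cvgrPdist_lt _ _).1 cvu _ e2).
have nuv : \forall y \near x, `|'D_u ('D_v f) x - 'D_u ('D_v f) y| < e / 2.
  exact: ((cvgrPdist_lt _ _).1 cuv _ e2).
have /nbhs_ballP[r /= r0 xr] : \forall y \near x,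
    [/\ [/\ differentiable f y, differentiable ('D_u f) y & differentiable ('D_v f) y],
     `|'D_v ('D_u f) x - 'D_v ('D_u f) y| < e / 2 &
     `|'D_u ('D_v f) x - 'D_u ('D_v f) y| < e / 2].
  apply: filterS3 df nvu nuv; first by move=> y; split.
(* The summand 1 keeps [K] positive even if [u] and [v] vanish; [h] is then small enough for the
   parallelogram to lie in the ball of radius [r]. *)
pose K := `|u| + `|v| + 1.
have K0 : 0 < K by rewrite ltr_wpDl// addr_ge0.
pose h := r / K / 2.
have h0 : 0 < h by rewrite !divr_gt0.
have rect s t : 0 <= s <= h -> 0 <= t <= h -> ball x r (x + s *: u + t *: v).
  move=> /andP[s0 sh] /andP[t0 th]; rewrite -ball_normE/= opprD addrA opprD addrA subrr sub0r.
  rewrite -opprD normrN (le_lt_trans (ler_normD _ _))// !normrZ !ger0_norm//.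
  apply: (@le_lt_trans _ _ (h * (`|u| + `|v|))).
    by rewrite mulrDr lerD// ler_wpM2r.
  rewrite (@lt_trans _ _ (h * K))// ?ltr_pM2l ?ltrDl//.
  have -> : h * K = r / 2 by rewrite /h; field; rewrite gt_eqF.
  by lra.
have [|s [t [sh th E1]]] := @second_difference f x u v h h0.
  by move=> s t sh th; have [[]] := xr _ (rect s t sh th).
have [|t' [s' [th' sh' E2]]] := @second_difference f x v u h h0.
  by move=> t' s' th' sh'; rewrite addrAC; have [[]] := xr _ (rect s' t' sh' th').
have E : 'D_v ('D_u f) (x + s *: u + t *: v) = 'D_u ('D_v f) (x + s' *: u + t' *: v).
  apply: (@mulfI _ (h * h)); first by rewrite mulf_neq0 ?gt_eqF.
  by rewrite -E1 [x + s' *: u + _]addrAC -E2 [x + h *: v + _]addrAC; ring.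
have [_ A1 _] := xr _ (rect _ _ sh th).
have [_ _ A2] := xr _ (rect _ _ sh' th').
by rewrite E in A1; rewrite addr0; exact: dist_half A1 A2.
Qed.

End Schwarz.

Lemma partialC (R : realType) m (U : set 'rV[R]_m) (f : 'rV[R]_m -> R) a b x :
  open U -> smooth_on U f -> U x ->
  partial a (partial b f) x = partial b (partial a f) x.
Proof.
move=> oU sf Ux; apply: schwarz.
- near=> y; split; near: y; apply: smooth_differentiable_near oU _ Ux => //;
  exact: smooth_partial.
- by have [_ /(_ b)[_ /(_ a)]] := sf 2%N; apply.
- by have [_ /(_ a)[_ /(_ b)]] := sf 2%N; apply.
Unshelve. all: by end_near. Qed.

(** * Bilinear forms given by matrices *)

Section Bform.
Context {R : realType}.

Lemma bformE n (G : 'M[R]_n) (u v : 'rV[R]_n) :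
  bform G u v = \sum_i \sum_j u 0 i * G i j * v 0 j.
Proof.
rewrite /bform mxE exchange_big/=; apply: eq_bigr => j _.
by rewrite !mxE mulr_suml.
Qed.

Lemma bformC n (G : 'M[R]_n) (u v : 'rV[R]_n) : G^T = G -> bform G u v = bform G v u.
Proof.
move=> sG; have E : v *m G *m u^T = (u *m G *m v^T)^T.
  by rewrite !trmx_mul trmxK sG mulmxA.
by rewrite /bform E [RHS]mxE.
Qed.

Lemma bformDl n (G : 'M[R]_n) (u v w : 'rV[R]_n) :
  bform G (u + v) w = bform G u w + bform G v w.
Proof. by rewrite /bform !mulmxDl mxE. Qed.

Lemma bformZl n (G : 'M[R]_n) (k : R) (u w : 'rV[R]_n) :
  bform G (k *: u) w = k * bform G u w.
Proof. by rewrite /bform -!scalemxAl mxE. Qed.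

Lemma bformDr n (G : 'M[R]_n) (u v w : 'rV[R]_n) :
  bform G w (u + v) = bform G w u + bform G w v.
Proof. by rewrite /bform linearD mulmxDr mxE. Qed.

Lemma bformZr n (G : 'M[R]_n) (k : R) (u w : 'rV[R]_n) :
  bform G w (k *: u) = k * bform G w u.
Proof. by rewrite /bform linearZ/= -scalemxAr mxE. Qed.

Lemma bformNl n (G : 'M[R]_n) (u w : 'rV[R]_n) : bform G (- u) w = - bform G u w.
Proof. by rewrite -scaleN1r bformZl mulN1r. Qed.

Lemma bform_suml n (G : 'M[R]_n) (I : Type) (r : seq I) (u : I -> 'rV[R]_n) w :
  bform G (\sum_(i <- r) u i) w = \sum_(i <- r) bform G (u i) w.
Proof. by rewrite /bform !mulmx_suml summxE. Qed.

Lemma bform_mulmx n p (G : 'M[R]_n) (P : 'M[R]_(p, n)) (u v : 'rV[R]_p) :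
  bform G (u *m P) (v *m P) = bform (P *m G *m P^T) u v.
Proof. by rewrite /bform trmx_mul !mulmxA. Qed.

Lemma bform_row n p (G : 'M[R]_n) (P : 'M[R]_(p, n)) i j :
  bform G (row i P) (row j P) = (P *m G *m P^T) i j.
Proof.
by rewrite !rowE bform_mulmx /bform trmx_delta -rowE -colE !mxE.
Qed.

Lemma posdef_unitmx n (G : 'M[R]_n) :
  (forall v, v != 0 -> 0 < bform G v v) -> G \in unitmx.
Proof.
move=> Gpos; rewrite -row_free_unit; apply/row_freeP; apply/row_freeP/inj_row_free => v vG.
apply/eqP; apply: contraT => /Gpos; rewrite /bform vG mul0mx mxE.
by rewrite ltxx.
Qed.

Lemma posdef_invmx_ge0 n (G : 'M[R]_n) (u : 'rV[R]_n) : G^T = G ->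
  (forall v, v != 0 -> 0 < bform G v v) -> 0 <= bform (invmx G) u u.
Proof.
move=> sG Gpos; have Gu := posdef_unitmx Gpos.
have -> : bform (invmx G) u u = bform G (u *m invmx G) (u *m invmx G).
  by rewrite bform_mulmx trmx_inv sG mulVmx// mul1mx.
have [->|/Gpos/ltW//] := eqVneq (u *m invmx G) 0.
by rewrite /bform !mul0mx mxE.
Qed.

(** The transformation law of the inverse metric, with [P] a Jacobian acting on covectors. *)
Lemma invmx_congruence n (P G : 'M[R]_n) : P \in unitmx -> G \in unitmx ->
  P^T *m invmx (P *m G *m P^T) *m P = invmx G.
Proof.
move=> Pu Gu; have Au : P *m G *m P^T \in unitmx by rewrite !unitmx_mul unitmx_tr Pu Gu.
set A := _ *m P^T in Au *.
have : P *m (G *m (P^T *m invmx A *m P)) = P by rewrite !mulmxA mulmxV ?mul1mx.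
move=> /(congr1 (mulmx (invmx P))); rewrite !mulKmx ?mulVmx// => GI.
by rewrite -[LHS](mulKmx Gu) GI mulmx1.
Qed.

Lemma partial_cst m (V : normedModType R) (k : V) a (x : 'rV[R]_m) :
  partial a (fun=> k) x = 0.
Proof. exact: derive_cst. Qed.

(** Differentiability is part of the conclusion because the induction step of the sum rule needs it
    for the tail. *)
Lemma partial_sum m (I : Type) (r : seq I) (F : I -> 'rV[R]_m -> R) a x :
  (forall i, differentiable (F i) x) ->
  differentiable (fun y => \sum_(i <- r) F i y) x /\
  partial a (fun y => \sum_(i <- r) F i y) x = \sum_(i <- r) partial a (F i) x.
Proof.
move=> dF; elim: r => [|i r [dr pr]].
  have -> : (fun y => \sum_(i <- [::]) F i y) = (fun=> 0).
    by apply/funext => y; rewrite big_nil.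
  by rewrite big_nil partial_cst; split=> //; exact: differentiable_cst.
have -> : (fun y => \sum_(j <- i :: r) F j y) = (fun y => F i y + \sum_(j <- r) F j y).
  by apply/funext => y; rewrite big_cons.
by rewrite big_cons partialD// pr; split=> //; exact: differentiableD.
Qed.

Lemma partial_bform m n (G : 'M[R]_n) (u v : 'rV[R]_m -> 'rV[R]_n) a x :
  differentiable u x -> differentiable v x ->
  partial a (fun y => bform G (u y) (v y)) x =
  bform G (partial a u x) (v x) + bform G (u x) (partial a v x).
Proof.
move=> du dv.
have duG i j : differentiable (fun y => u y 0 i * G i j) x.
  by apply: differentiableM; [exact: differentiable_entry|exact: differentiable_cst].
have dF i j : differentiable (fun y => u y 0 i * G i j * v y 0 j) x.
  by apply: differentiableM => //; exact: differentiable_entry.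
have dS i : differentiable (fun y => \sum_j u y 0 i * G i j * v y 0 j) x.
  by have [] := partial_sum (index_enum _) a (dF i).
have -> : (fun y => bform G (u y) (v y)) =
    (fun y => \sum_i \sum_j u y 0 i * G i j * v y 0 j).
  by apply/funext => y; rewrite bformE.
rewrite (partial_sum _ a dS).2 !bformE -big_split/=; apply: eq_bigr => i _.
rewrite (partial_sum _ a (dF i)).2 -big_split/=; apply: eq_bigr => j _.
rewrite partialM//; last exact: differentiable_entry.
rewrite partialM; [|exact: differentiable_entry|exact: differentiable_cst].
rewrite partial_cst mulr0 add0r -!partial_entry//; ring.
Qed.

End Bform.

#[local] Opaque partial bform.

(** * The Gauss formula in a flat ambient space *)

Section Gauss.
Context {R : realType}.

Lemma christoffel_cst n (G : 'M[R]_n) (y : 'rV[R]_n) k i j :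
  christoffel (fun=> G) y k i j = 0.
Proof.
rewrite /christoffel big1 ?mulr0// => l _.
by rewrite !partial_cst addr0 subr0 mulr0.
Qed.

Lemma cov_along_cst m n (G : 'M[R]_n) (f V : 'rV[R]_m -> 'rV[R]_n) a x :
  cov_along (fun=> G) f V a x = partial a V x.
Proof.
apply/rowP => k; rewrite mxE big1 ?addr0// => i _; rewrite big1// => j _.
by rewrite christoffel_cst !mul0r.
Qed.

Variables (m n : nat) (U : set 'rV[R]_m) (G : 'M[R]_n) (f : 'rV[R]_m -> 'rV[R]_n).
Variable (S : 'rV[R]_m -> 'M[R]_m).
Hypotheses (oU : open U) (sG : G^T = G) (sf : smooth_on U f).
Hypothesis SE : forall x, U x -> forall a b,
  S x a b = bform G (partial a f x) (partial b f x).

Let smooth_Df a : smooth_on U (partial a f). Proof. exact: smooth_partial. Qed.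

Let partial_S a b l x : U x -> partial l (fun y => S y a b) x =
  bform G (partial l (partial a f) x) (partial b f x) +
  bform G (partial l (partial b f) x) (partial a f x).
Proof.
move=> Ux; rewrite (@near_eq_partial _ _ _ _ (fun y => bform G (partial a f y) (partial b f y))).
  rewrite partial_bform; [|exact: smooth_differentiable (@smooth_Df _) Ux..].
  by rewrite [X in _ + X = _]bformC.
by apply: filterS (open_nbhs_nbhs (conj oU Ux)) => y Uy; rewrite SE.
Qed.

Lemma partialC_row a b x : U x -> partial a (partial b f) x = partial b (partial a f) x.
Proof.
move=> Ux; apply/rowP => k.
have pE (c d : 'I_m) : partial c (partial d f) x 0 k =
    partial c (partial d (fun y => f y 0 k)) x.
  rewrite partial_entry; last exact: smooth_differentiable (@smooth_Df _) Ux.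
  apply: near_eq_partial; apply: filterS (open_nbhs_nbhs (conj oU Ux)) => y Uy.
  by rewrite partial_entry//; exact: smooth_differentiable Uy.
apply: etrans (pE a b) _; apply: etrans _ (esym (pE b a)).
by apply: (@partialC _ _ U (fun y => f y 0 k)) => //; exact: smooth_entry.
Qed.

(** Differentiating the induced metric turns the three terms of [christoffel] into six; symmetry of
    second derivatives cancels four of them, and the remaining two are equal, which absorbs the
    factor 1/2. *)
Lemma christoffel_induced x k a b : U x ->
  christoffel S x k a b =
  \sum_l invmx (S x) k l * bform G (partial a (partial b f) x) (partial l f x).
Proof.
move=> Ux; rewrite /christoffel mulr_sumr; apply: eq_bigr => l _.
rewrite !partial_S//.
rewrite (partialC_row b a Ux).
rewrite (partialC_row l a Ux).
rewrite (partialC_row l b Ux).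
have two_halves (A B C D : R) : 2^-1 * (D * (A + B + (A + C) - (B + C))) = D * A by field.
exact: two_halves.
Qed.

(** The tangential part of the flat second derivative is the Christoffel term by
    [christoffel_induced], so the normal part is the covariant Hessian of [f]. *)
Lemma gauss_formula x a b : U x -> (S x)^T = S x ->
  normal_part (S x) G (fun c => partial c f x) (partial a (partial b f) x) =
  partial a (partial b f) x - \sum_k christoffel S x k a b *: partial k f x.
Proof.
move=> Ux sS; rewrite /normal_part exchange_big/=; congr (_ - _).
apply: eq_bigr => k _; rewrite christoffel_induced// scaler_suml.
apply: eq_bigr => l _; congr (_ * _ *: _).
(* [normal_part] and [christoffel] contract the inverse metric in opposite index orders; its
   symmetry reconciles them. *)
by rewrite -[in RHS]sS -trmx_inv mxE.
Qed.

Lemma mean_curvature_gauss x : U x -> (S x)^T = S x ->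
  mean_curvature_local S (fun=> G) f x =
  \sum_a \sum_b invmx (S x) a b *: (partial a (partial b f) x -
     \sum_k christoffel S x k a b *: partial k f x).
Proof.
move=> Ux sS; rewrite /mean_curvature_local; apply: eq_bigr => a _.
by apply: eq_bigr => b _; rewrite cov_along_cst gauss_formula.
Qed.

End Gauss.

#[local] Transparent partial bform.

(** * Changes of charts *)

Section Charts.
Context {R : realType} {n : nat} {M : manifold R n}.
Implicit Types (c d : chart R M n) (p : M).

Lemma chart_at_atlas p : atlas (chart_at p).
Proof. exact: s2valP (cid2 (atlas_cover p)). Qed.

Lemma chart_at_dom p : dom (chart_at p) p.
Proof. exact: s2valP' (cid2 (atlas_cover p)). Qed.

Lemma near_cod d x : cod d x -> \forall y \near x, cod d y.
Proof. by move=> dx; apply: open_nbhs_nbhs; split=> //; exact: cod_open. Qed.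

Lemma near_para d (A : set M) x : open A -> cod d x -> A (para d x) ->
  \forall y \near x, A (para d y).
Proof.
move=> oA dx Ax; apply: (para_continuous dx).
exact: open_nbhs_nbhs.
Qed.

Lemma transition_domE c c' : coord c @` (dom c `&` dom c') =
  [set x | cod c x /\ dom c' (para c x)].
Proof.
apply/seteqP; split=> [_ [p [cp c'p] <-]|x [cx c'x]] /=.
  by have [? ->] := coordK cp.
by have [cpx xE] := paraK cx; exists (para c x).
Qed.

Lemma transition_dom_open c c' : open (coord c @` (dom c `&` dom c')).
Proof.
rewrite transition_domE openE => x [cx c'x].
by apply: filterI; [exact: near_cod|exact: near_para (dom_open c') _ _].
Qed.

Lemma transition_differentiable c c' p : atlas c -> atlas c' -> dom c p -> dom c' p ->
  differentiable (transition c c') (coord c p).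
Proof.
move=> Ac Ac' cp c'p; apply: (smooth_differentiable (atlas_smooth Ac Ac')).
by exists p.
Qed.

Lemma jacobian_row c c' p a : atlas c -> atlas c' -> dom c p -> dom c' p ->
  row a (jacobian (transition c c') (coord c p)) =
  partial a (transition c c') (coord c p).
Proof.
by move=> *; rewrite rowE /partial deriveEjacobian//; exact: transition_differentiable.
Qed.

Lemma partial_transition c c' p (V : normedModType R) (f : M -> V) a :
  atlas c -> atlas c' -> dom c p -> dom c' p ->
  differentiable (f \o para c') (coord c' p) ->
  partial a (f \o para c) (coord c p) =
  \sum_i jacobian (transition c c') (coord c p) a i *:
    partial i (f \o para c') (coord c' p).
Proof.
move=> Ac Ac' cp c'p df; have [ccp cpE] := coordK cp.
have TE : transition c c' (coord c p) = coord c' p by rewrite /transition/= cpE.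
rewrite (@near_eq_partial _ _ _ _ ((f \o para c') \o transition c c')).
  rewrite partial_comp ?TE//; last exact: transition_differentiable.
  by apply: eq_bigr => i _; rewrite -jacobian_row// mxE.
have : (coord c @` (dom c `&` dom c')) (coord c p) by exists p.
move=> cc'; have := open_nbhs_nbhs (conj (@transition_dom_open c c') cc').
apply: filterS => y; rewrite transition_domE => -[cy c'y] /=.
by rewrite /transition/=; have [_ ->] := coordK c'y.
Qed.

Lemma continuous_chartwise (T : topologicalType) (f : M -> T) :
  (forall d x, atlas d -> cod d x -> {for x, continuous (f \o para d)}) ->
  continuous f.
Proof.
move=> cf p; have Ad := chart_at_atlas p; have dp := chart_at_dom p.
set d := chart_at p in Ad dp *; have [dx pE] := coordK dp.
have : {for p, continuous ((f \o para d) \o coord d)}.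
  by apply: continuous_comp; [exact: Defs.coord_continuous|exact: cf].
apply: near_eq_continuous.
apply: filterS (open_nbhs_nbhs (conj (dom_open d) dp)) => q dq /=.
by have [_ ->] := coordK dq.
Qed.

End Charts.

(** * The inverse metric under changes of charts *)

Section Metric.
Context {R : realType} {n : nat} {M : manifold R n}.
Variables (g : metric M) (g_riem : riemannian g).
Implicit Types (c d : chart R M n) (p : M).

Lemma gcomp_unit d x : atlas d -> cod d x -> gcomp g d x \in unitmx.
Proof. by move=> Ad dx; apply: posdef_unitmx => v; exact: g_riem. Qed.

(** The Jacobian is a factor of the invertible matrix [gcomp g c], so the inverse transition need
    not be differentiated. *)
Lemma jacobian_unit c c' p : atlas c -> atlas c' -> dom c p -> dom c' p ->
  jacobian (transition c c') (coord c p) \in unitmx.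
Proof.
move=> Ac Ac' cp c'p; have := @gcomp_unit c (coord c p) Ac (coordK cp).1.
by rewrite (metric_law g Ac Ac' cp c'p) !unitmx_mul => /andP[/andP[]].
Qed.

Lemma cometric_law c c' p (u v u' v' : 'rV[R]_n) :
  atlas c -> atlas c' -> dom c p -> dom c' p ->
  let J := jacobian (transition c c') (coord c p) in
  u = u' *m J^T -> v = v' *m J^T ->
  bform (invmx (gcomp g c (coord c p))) u v =
  bform (invmx (gcomp g c' (coord c' p))) u' v'.
Proof.
move=> Ac Ac' cp c'p J -> ->; rewrite bform_mulmx trmxK.
rewrite (metric_law g Ac Ac' cp c'p) -/J invmx_congruence//.
  exact: jacobian_unit.
by apply: gcomp_unit => //; exact: (coordK c'p).1.
Qed.

End Metric.

(** * Determinants and inverses of C^1 matrices *)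

Section C1Matrix.
Context {R : realType} {m : nat}.

Lemma C1_prod (I : Type) (r : seq I) (F : I -> 'rV[R]_m -> R) x :
  (forall i, C1_at (F i) x) -> C1_at (fun y => \prod_(i <- r) F i y) x.
Proof.
move=> cF; elim: r => [|i r IH].
  by apply: near_eq_C1 (C1_cst 1 x); near=> y; rewrite big_nil.
by apply: near_eq_C1 (C1M (cF i) IH); near=> y; rewrite big_cons.
Unshelve. all: by end_near. Qed.

Lemma C1_det n (A : 'rV[R]_m -> 'M[R]_n) x :
  (forall i j, C1_at (fun y => A y i j) x) -> C1_at (fun y => \det (A y)) x.
Proof.
move=> cA; apply: C1_sum => s _; apply: C1M; first exact: C1_cst.
exact: C1_prod.
Qed.

(** Cramer's rule: each entry of the inverse is a cofactor over the determinant, both polynomial in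
    the entries. *)
Lemma C1_invmx n (A : 'rV[R]_m -> 'M[R]_n) x i j :
  (\forall y \near x, A y \in unitmx) ->
  (forall k l, C1_at (fun y => A y k l) x) -> C1_at (fun y => invmx (A y) i j) x.
Proof.
move=> Au cA.
apply: (@near_eq_C1 _ _ (fun y => (\det (A y))^-1 *
    ((-1) ^+ (j + i) * \det (row' j (col' i (A y)))))).
  by apply: filterS Au => y Ay; rewrite /invmx Ay !mxE.
apply: C1M.
  apply: C1V; last exact: C1_det.
  by have := nbhs_singleton Au; rewrite unitmxE unitfE.
apply: C1M; first exact: C1_cst.
apply: C1_det => k l; apply: near_eq_C1 (cA (lift j k) (lift i l)).
by near=> y; rewrite !mxE.
Unshelve. all: by end_near. Qed.

Lemma C1_bform n (G : 'rV[R]_m -> 'M[R]_n) (u v : 'rV[R]_m -> 'rV[R]_n) x :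
  (forall i j, C1_at (fun y => G y i j) x) ->
  (forall i, C1_at (fun y => u y 0 i) x) -> (forall i, C1_at (fun y => v y 0 i) x) ->
  C1_at (fun y => bform (G y) (u y) (v y)) x.
Proof.
move=> cG cu cv; apply: (@near_eq_C1 _ _
    (fun y => \sum_i \sum_j u y 0 i * G y i j * v y 0 j)).
  by near=> y; rewrite bformE.
by apply: C1_sum => i _; apply: C1_sum => j _; apply: C1M => //; exact: C1M.
Unshelve. all: by end_near. Qed.

End C1Matrix.

(** * Differentials and gradients on the surface *)

Section SurfaceCalculus.
Context {R : realType} {S : manifold R 2}.
Variables (sigma : metric S) (sigma_riem : riemannian sigma).
Implicit Types (d : chart R S 2) (p : S) (f : S -> R).

Definition C1_surface f : Prop :=
  forall d x, atlas d -> cod d x -> C1_at (f \o para d) x.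

Lemma C1_surface_continuous f : C1_surface f -> continuous f.
Proof. by move=> cf; apply: continuous_chartwise => d x Ad dx; exact/C1_continuous/cf. Qed.

Lemma C1_surface_differentiable f d p : C1_surface f -> atlas d -> dom d p ->
  differentiable (f \o para d) (coord d p).
Proof. by move=> cf Ad dp; apply: C1_differentiable; apply: cf => //; exact: (coordK dp).1. Qed.

(** Written as a row, so that it obeys the same law as the components of a [one_form]. *)
Definition differential d f p : 'rV[R]_2 := \row_a pd d f a p.

Lemma differential_law d d' f p : C1_surface f ->
  atlas d -> atlas d' -> dom d p -> dom d' p ->
  differential d f p =
  differential d' f p *m (jacobian (transition d d') (coord d p))^T.
Proof.
move=> cf Ad Ad' dp d'p; apply/rowP => a; rewrite !mxE /pd.
rewrite (partial_transition a Ad Ad' dp d'p); last exact: C1_surface_differentiable.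
by apply: eq_bigr => i _; rewrite !mxE mulrC.
Qed.

(** With [d] fixed, the value at nearby points becomes one expression that can be differentiated,
    which [chart_at p] does not allow. *)
Lemma grad_sqE f d p : C1_surface f -> atlas d -> dom d p ->
  grad_sq sigma f p =
  bform (sigma_inv sigma d p) (differential d f p) (differential d f p).
Proof.
move=> cf Ad dp; rewrite /sigma_inv.
have dat := chart_at_atlas p; have dom_at := chart_at_dom p.
rewrite -(@cometric_law _ _ _ _ sigma_riem (chart_at p) d p
  (differential (chart_at p) f p) (differential (chart_at p) f p))//;
  try exact: differential_law.
rewrite bformE /grad_sq; apply: eq_bigr => a _; apply: eq_bigr => b _.
by rewrite !mxE; congr (_ * _); exact: mulrC.
Qed.

Lemma grad_sq_ge0 f p : 0 <= grad_sq sigma f p.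
Proof.
have dp := chart_at_dom p; have Ad := chart_at_atlas p.
have -> : grad_sq sigma f p = bform (sigma_inv sigma (chart_at p) p)
    (differential (chart_at p) f p) (differential (chart_at p) f p).
  rewrite bformE /grad_sq; apply: eq_bigr => a _; apply: eq_bigr => b _.
  by rewrite !mxE; congr (_ * _); exact: mulrC.
have dx := (coordK dp).1; rewrite /sigma_inv.
apply: posdef_invmx_ge0 => [|v v0]; first exact: (Defs.metric_sym sigma Ad dx).
exact: sigma_riem.
Qed.

Lemma C1_sigma_inv d x i j : atlas d -> cod d x ->
  C1_at (fun y => invmx (gcomp sigma d y) i j) x.
Proof.
move=> Ad dx; apply: C1_invmx.
  by apply: filterS (near_cod dx) => y; exact: gcomp_unit.
move=> k l; apply: smooth_C1_entry dx; [exact: cod_open|exact: metric_smooth].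
Qed.

End SurfaceCalculus.

(** * Fields along a map, and immersions into Minkowski space *)

Section Immersions.
Context {R : realType} {S : manifold R 2} (sigma : metric S).
Implicit Types (d : chart R S 2) (p : S).

Section AlongMap.
Variables (N : spacetime R) (F : S -> N) (smF : smooth_map F).
Implicit Types (c : chart R N 4) (V W : vfield_along F).

Lemma overlap_open d c : open (overlap F d c).
Proof.
rewrite openE => x [dx cFx]; apply: filterI; first exact: near_cod.
apply: (@near_para _ _ _ d (F @^-1` dom c)) => //.
by move: (smF.1) => /continuousP; apply; exact: dom_open.
Qed.

Lemma inner_chartE V W c p : atlas c -> dom c (F p) ->
  inner V W p = form_at F c p (vcomp V c p) (vcomp W c p).
Proof.
move=> Ac cFp; rewrite /inner /form_at.
have Ac' := chart_at_atlas (F p); have c'Fp := chart_at_dom (F p).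
rewrite (vfield_law V Ac' Ac c'Fp cFp) (vfield_law W Ac' Ac c'Fp cFp).
by rewrite bform_mulmx -(metric_law (smetric N) Ac' Ac c'Fp cFp).
Qed.

Lemma C1_vcomp V d c x i : atlas d -> atlas c -> overlap F d c x ->
  C1_at (fun y => vcomp V c (para d y) 0 i) x.
Proof.
move=> Ad Ac; apply: (@smooth_C1_entry _ _ _ _ _ (vcomp V c \o para d)).
  exact: overlap_open.
exact: vfield_smooth.
Qed.

Lemma C1_metric_along d c x i j : atlas d -> atlas c -> overlap F d c x ->
  C1_at (fun y => gcomp (smetric N) c (local_rep F d c y) i j) x.
Proof.
move=> Ad Ac dcx; have sF := smF.2 d c Ad Ac.
apply: (@C1_comp _ _ _ (local_rep F d c) (fun z => gcomp (smetric N) c z i j)).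
- exact: smooth_differentiable_near (@overlap_open d c) sF dcx.
- by move=> k; exact: smooth_C1_entry (@overlap_open d c) sF dcx.
- apply: (smooth_C1_entry _ _ (@cod_open _ _ _ c) (metric_smooth (smetric N) Ac)).
  by have [cFx _] := coordK dcx.2.
Qed.

Lemma C1_inner V W : C1_surface (inner V W).
Proof.
(* The chart of [N] chosen at the base point is kept for all nearby points, as [inner_chartE]
   permits. *)
move=> d x Ad dx; set c := chart_at (F (para d x)).
have Ac : atlas c := chart_at_atlas _.
have dcx : overlap F d c x by split=> //; exact: chart_at_dom.
apply: (@near_eq_C1 _ _ (fun y => bform (gcomp (smetric N) c (local_rep F d c y))
   (vcomp V c (para d y)) (vcomp W c (para d y)))).
  apply: filterS (open_nbhs_nbhs (conj (@overlap_open d c) dcx)) => y [dy cFy].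
  by rewrite /= (inner_chartE _ _ Ac cFy).
by apply: C1_bform => [i j|i|i]; [exact: C1_metric_along|exact: C1_vcomp..].
Qed.

Lemma mc_norm_gt0 (E : extrinsic_data sigma F) p : 0 < mc_norm E p.
Proof. by rewrite sqrtr_gt0; exact: mcv_spacelike. Qed.

Lemma C1_mc_norm (E : extrinsic_data sigma F) : C1_surface (mc_norm E).
Proof.
move=> d x Ad dx; apply: C1_sqrt; first exact: mcv_spacelike.
exact: C1_inner.
Qed.

End AlongMap.

Section IntoMinkowski.
Variables (X : S -> minkowski_space R) (X_iso : isometric_embedding sigma X).
Variables (sigma_riem : riemannian sigma) (T0 : 'rV[R]_4).
Local Notation std := (std_chart 4).
Local Notation eta := (minkowski_form R).

Lemma atlas_std : atlas (std : chart R (minkowski_space R) 4).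
Proof. by []. Qed.

Lemma overlap_std d : overlap X d std = cod d.
Proof. by apply/seteqP; split=> [x []|x dx]. Qed.

Lemma smooth_local_rep d : atlas d -> smooth_on (cod d) (local_rep X d std).
Proof.
move=> Ad; rewrite -overlap_std; have [_ [_ smX] _] := X_iso.
exact: (smX d std).
Qed.

Lemma partial_local_rep_row d x a : atlas d -> cod d x ->
  row a (jacobian (local_rep X d std) x) = partial a (local_rep X d std) x.
Proof.
move=> Ad dx; rewrite rowE /partial deriveEjacobian//.
exact: smooth_differentiable (smooth_local_rep Ad) dx.
Qed.

Lemma induced_metricE d x a b : atlas d -> cod d x ->
  gcomp sigma d x a b =
  bform eta (partial a (local_rep X d std) x) (partial b (local_rep X d std) x).
Proof.
move=> Ad dx; have [_ _ iso] := X_iso.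
have dcx : overlap X d std x by rewrite overlap_std.
rewrite (iso d std x Ad atlas_std dcx).
by rewrite -!partial_local_rep_row// bform_row.
Qed.

Lemma minkowski_form_sym : eta^T = eta.
Proof. by rewrite /minkowski_form tr_diag_mx. Qed.

(** Isometry makes [sigma] the induced metric, so the flat Gauss formula applies in every chart of
    the surface. *)
Lemma mean_curvatureE (H : vfield_along X) d p : is_mean_curvature sigma H ->
  atlas d -> dom d p ->
  vcomp H std p = \sum_a \sum_b sigma_inv sigma d p a b *:
    (partial a (partial b (local_rep X d std)) (coord d p) -
     \sum_k christoffel (gcomp sigma d) (coord d p) k a b *:
       partial k (local_rep X d std) (coord d p)).
Proof.
move=> HP Ad dp; have [dx _] := coordK dp; rewrite (HP d std)//.
apply: (@mean_curvature_gauss _ _ _ (cod d)) => //.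
- exact: cod_open.
- exact: minkowski_form_sym.
- exact: smooth_local_rep.
- by move=> x cx a b; exact: induced_metricE.
- exact: (Defs.metric_sym sigma Ad).
Qed.

Lemma partial_height m (u : 'rV[R]_m -> 'rV[R]_4) a x : differentiable u x ->
  partial a (fun y => - bform eta (u y) T0) x = - bform eta (partial a u x) T0.
Proof.
move=> du; have -> : (fun y => - bform eta (u y) T0) = (fun y => bform eta (u y) (- T0)).
  by apply/funext => y; rewrite -[- T0]scaleN1r bformZr mulN1r.
rewrite partial_bform//.
by rewrite partial_cst -[- T0]scaleN1r bformZr mulN1r -[0](scale0r 0) bformZr mul0r addr0.
Qed.

Lemma tauE d : tau X T0 \o para d = (fun y => - bform eta (local_rep X d std y) T0).
Proof. by []. Qed.

(** Pairing with the constant vector [T0] commutes with all derivatives, so this is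
    [mean_curvatureE] paired with [- T0]. *)
Lemma laplacian_tau (H : vfield_along X) p : is_mean_curvature sigma H ->
  laplacian sigma (tau X T0) p = - bform eta (vcomp H std p) T0.
Proof.
move=> HP; have dp := chart_at_dom p; have Ad := chart_at_atlas p.
rewrite (mean_curvatureE HP Ad dp) /laplacian; set d := chart_at p in dp Ad *.
have [dx _] := coordK dp; set x := coord d p in dx *.
have sX := smooth_local_rep Ad.
(* Stated on all of [cod d], because differentiating once more requires equality of germs. *)
have D1 y b : cod d y -> partial b (tau X T0 \o para d) y =
    - bform eta (partial b (local_rep X d std) y) T0.
  by move=> dy; rewrite tauE partial_height//; exact: smooth_differentiable sX dy.
have D2 a b : partial a (partial b (tau X T0 \o para d)) x =
    - bform eta (partial a (partial b (local_rep X d std)) x) T0.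
  rewrite -partial_height; last exact: (smooth_differentiable (smooth_partial b sX) dx).
  apply: near_eq_partial; apply: filterS (near_cod dx) => y; exact: D1.
rewrite bform_suml -sumrN; apply: eq_bigr => a _.
rewrite bform_suml -sumrN; apply: eq_bigr => b _.
rewrite D2 bformZl bformDl bformNl bform_suml -mulrN opprB addrC; congr (_ * (_ - _)).
by rewrite -sumrN; apply: eq_bigr => k _; rewrite /pd D1// bformZl mulrN opprK.
Qed.

Lemma C1_height (u : 'rV[R]_2 -> 'rV[R]_4) x :
  (forall i, C1_at (fun y => u y 0 i) x) -> C1_at (fun y => - bform eta (u y) T0) x.
Proof.
move=> cu; apply: C1N; apply: C1_bform => [i j|i|i]; [|exact: cu|]; exact: C1_cst.
Qed.

Lemma C1_position g : C1_surface (position X g).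
Proof.
move=> d x Ad dx.
exact: (smooth_C1_entry _ _ (@cod_open _ _ _ d) (smooth_local_rep Ad) dx).
Qed.

Lemma C1_tau : C1_surface (tau X T0).
Proof.
move=> d x Ad dx; apply: C1_height => i.
exact: (smooth_C1_entry _ _ (@cod_open _ _ _ d) (smooth_local_rep Ad) dx).
Qed.

Lemma C1_laplacian_tau (H : vfield_along X) : is_mean_curvature sigma H ->
  C1_surface (laplacian sigma (tau X T0)).
Proof.
move=> HP d x Ad dx; have [_ smX _] := X_iso.
apply: (@near_eq_C1 _ _ (fun y => - bform eta (vcomp H std (para d y)) T0)).
  by near=> y; rewrite /= (laplacian_tau _ HP).
by apply: C1_height => i; apply: C1_vcomp => //; rewrite overlap_std.
Unshelve. all: by end_near. Qed.

(** [grad_sq] already contains first derivatives, so [f] must have one order of regularity more than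
    the result; the first hypothesis supplies it. *)
Lemma C1_grad_sq f : (forall d a x, atlas d -> cod d x -> C1_at (partial a (f \o para d)) x) ->
  C1_surface f -> C1_surface (grad_sq sigma f).
Proof.
move=> cpf cf d x Ad dx; apply: (@near_eq_C1 _ _ (fun y =>
    bform (invmx (gcomp sigma d y)) (\row_a partial a (f \o para d) y)
      (\row_a partial a (f \o para d) y))).
  apply: filterS (near_cod dx) => y dy; have [dpy yE] := paraK dy.
  rewrite /= (grad_sqE sigma_riem cf Ad dpy) /sigma_inv yE.
  suff -> : differential d f (para d y) = \row_a partial a (f \o para d) y by [].
  by apply/rowP => a; rewrite !mxE /pd yE.
apply: C1_bform => [i j|i|i]; first exact: C1_sigma_inv.
  by apply: near_eq_C1 (cpf d i x Ad dx); near=> y; rewrite mxE.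
by apply: near_eq_C1 (cpf d i x Ad dx); near=> y; rewrite mxE.
Unshelve. all: by end_near. Qed.

Lemma C1_grad_sq_tau : C1_surface (grad_sq sigma (tau X T0)).
Proof.
apply: C1_grad_sq; last exact: C1_tau.
move=> d a x Ad dx; have sX := smooth_local_rep Ad.
apply: (@near_eq_C1 _ _ (fun y => - bform eta (partial a (local_rep X d std) y) T0)).
  apply: filterS (near_cod dx) => y dy.
  by rewrite tauE partial_height//; exact: smooth_differentiable sX dy.
apply: C1_height => i.
exact: (smooth_C1_entry _ _ (@cod_open _ _ _ d) (smooth_partial a sX) dx).
Qed.

End IntoMinkowski.

End Immersions.

(** * Regularity of rho and of the current *)

Section Currents.
Context {R : realType} {S : manifold R 2} (sigma : metric S).
Hypothesis sigma_riem : riemannian sigma.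
Variables (N : spacetime R) (F : S -> N) (smF : smooth_map F).
Variables (E : extrinsic_data sigma F).
Variables (X : S -> minkowski_space R) (X_iso : isometric_embedding sigma X).
Variables (E0 : extrinsic_data sigma X) (T0 : 'rV[R]_4).
Implicit Types (d : chart R S 2) (p : S).

Let smX : smooth_map X. Proof. by case: X_iso. Qed.

Let potential (q : S) : R := arsinh (rho E E0 T0 q * laplacian sigma (tau X T0) q /
  (mc_norm E0 q * mc_norm E q)).

(** Roots and denominators stay off their singularities: both mean curvature norms are positive and
    [1 + grad_sq] is at least 1. *)
Lemma C1_rho : C1_surface (rho E E0 T0).
Proof.
move=> d x Ad dx.
have g0 p : 0 < 1 + grad_sq sigma (tau X T0) p.
  by rewrite ltr_pwDl// (grad_sq_ge0 sigma_riem).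
have Cg : C1_at (fun y => 1 + grad_sq sigma (tau X T0) (para d y)) x.
  by apply: C1D; [exact: C1_cst|exact: (C1_grad_sq_tau X_iso sigma_riem)].
have Cw : C1_at (fun y => laplacian sigma (tau X T0) (para d y) ^+ 2 /
    (1 + grad_sq sigma (tau X T0) (para d y))) x.
  apply: C1M; last by apply: C1V => //; rewrite gt_eqF.
  by apply: C1X; exact: (C1_laplacian_tau X_iso T0 (mcvP E0)).
have w0 p (h : R) : 0 < h ->
    0 < h ^+ 2 + laplacian sigma (tau X T0) p ^+ 2 / (1 + grad_sq sigma (tau X T0) p).
  by move=> h0; rewrite ltr_pwDl ?exprn_gt0// divr_ge0 ?sqr_ge0// ltW.
apply: C1M; last first.
  apply: C1V; first by rewrite gt_eqF// sqrtr_gt0.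
  exact: C1_sqrt.
apply: C1B; apply: C1_sqrt.
- exact: w0 (mc_norm_gt0 E0 (para d x)).
- exact: C1D (C1X 2 (C1_mc_norm smX E0 Ad dx)) Cw.
- exact: w0 (mc_norm_gt0 E (para d x)).
- exact: C1D (C1X 2 (C1_mc_norm smF E Ad dx)) Cw.
Qed.

Lemma C1_potential : C1_surface potential.
Proof.
move=> d x Ad dx; apply: C1_arsinh; apply: C1M.
  apply: C1M; first exact: C1_rho.
  exact: (C1_laplacian_tau X_iso T0 (mcvP E0)).
apply: C1V; first by rewrite mulf_neq0// gt_eqF//; exact: mc_norm_gt0.
by apply: C1M; exact: C1_mc_norm.
Qed.

(** The current with its index lowered, a covector whose transformation law is known term by
    term. *)
Let coefficients d p : 'rV[R]_2 :=
  rho E E0 T0 p *: differential d (tau X T0) p - differential d potential p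
  - ocomp (alphaH E0) d p + ocomp (alphaH E) d p.

Lemma coefficients_law d d' p : atlas d -> atlas d' -> dom d p -> dom d' p ->
  coefficients d p =
  coefficients d' p *m (jacobian (transition d d') (coord d p))^T.
Proof.
move=> Ad Ad' dp d'p; rewrite /coefficients.
rewrite (differential_law (C1_tau X_iso T0) Ad Ad' dp d'p).
rewrite (differential_law C1_potential Ad Ad' dp d'p).
rewrite (one_form_law (alphaH E0) Ad Ad' dp d'p) (one_form_law (alphaH E) Ad Ad' dp d'p).
by rewrite !mulmxDl !mulNmx -scalemxAl.
Qed.

(** Contracting dX^g with the current amounts to applying the inverse metric to two covectors, which
    [cometric_law] frees from the chart. *)
Lemma current_derivE g d p : atlas d -> dom d p ->
  current_deriv E E0 T0 g p =
  bform (sigma_inv sigma d p) (differential d (position X g) p) (coefficients d p).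
Proof.
move=> Ad dp; have Ad' := chart_at_atlas p; have d'p := chart_at_dom p.
rewrite /sigma_inv (@cometric_law _ _ _ _ sigma_riem d (chart_at p) p _ _
  (differential (chart_at p) (position X g) p) (coefficients (chart_at p) p))//.
- rewrite bformE /current_deriv; apply: eq_bigr => a _; rewrite mulr_sumr.
  by apply: eq_bigr => b _; rewrite !mxE mulrA.
- exact: (differential_law (C1_position X_iso g)).
- exact: coefficients_law.
Qed.

(** The claim stops at continuity, because the current contains first derivatives of [potential],
    known only to be C^1. *)
Lemma continuous_current_deriv g : continuous (current_deriv E E0 T0 g).
Proof.
apply: continuous_chartwise => d x Ad dx.
pose u y : 'rV[R]_2 := \row_a partial a (position X g \o para d) y.
pose v y : 'rV[R]_2 := rho E E0 T0 (para d y) *: (\row_a partial a (tau X T0 \o para d) y)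
  - (\row_a partial a (potential \o para d) y)
  - ocomp (alphaH E0) d (para d y) + ocomp (alphaH E) d (para d y).
apply: (@near_eq_continuous _ _ (fun y =>
    \sum_i \sum_j u y 0 i * invmx (gcomp sigma d y) i j * v y 0 j)).
  apply: filterS (near_cod dx) => y dy; have [dpy yE] := paraK dy.
  rewrite /= (current_derivE g Ad dpy) -bformE /sigma_inv yE.
  have dE (f : S -> R) : differential d f (para d y) = \row_a partial a (f \o para d) y.
    by apply/rowP => a; rewrite !mxE /pd yE.
  by rewrite /coefficients !dE.
have cpf (f : S -> R) a : C1_surface f ->
    {for x, continuous (fun y => (\row_b partial b (f \o para d) y) 0 a)}.
  move=> cf; apply: (@near_eq_continuous _ _ (partial a (f \o para d))).
    by near=> y; rewrite mxE.
  by apply: C1_partial; exact: cf.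
have ca (al : one_form S) a : {for x, continuous (fun y => ocomp al d (para d y) 0 a)}.
  apply: C1_continuous.
  exact: (smooth_C1_entry _ _ (@cod_open _ _ _ d) (one_form_smooth al Ad) dx).
apply: continuous_sum => i _; apply: continuous_sum => j _.
have cu : {for x, continuous (fun y => u y 0 i)} := cpf _ i (C1_position X_iso g).
have cs : {for x, continuous (fun y => invmx (gcomp sigma d y) i j)}.
  by apply: C1_continuous; exact: C1_sigma_inv.
have cv : {for x, continuous (fun y => v y 0 j)}.
  apply: (@near_eq_continuous _ _ (fun y =>
    rho E E0 T0 (para d y) * (\row_a partial a (tau X T0 \o para d) y) 0 j
    - (\row_a partial a (potential \o para d) y) 0 j
    - ocomp (alphaH E0) d (para d y) 0 j + ocomp (alphaH E) d (para d y) 0 j)).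
    by near=> y; rewrite !mxE.
  have cr : {for x, continuous (rho E E0 T0 \o para d)}.
    by apply: C1_continuous; exact: C1_rho.
  have ct := cpf (tau X T0) j (C1_tau X_iso T0).
  have cp := cpf potential j C1_potential.
  exact: (continuousD (continuousB (continuousB (continuousM cr ct) cp)
    (ca (alphaH E0) j)) (ca (alphaH E) j)).
exact: (continuousM (continuousM cu cs) cv).
Unshelve. all: by end_near. Qed.

End Currents.

(** * Finite area and integrability of continuous functions *)

Section Integration.

(** The integral of a nonnegative function is a supremum over the simple functions below it, so it
    is monotone outright; this spares a measurability proof for the area density on the plane. *)
Lemma ge0_integral_le d (T : measurableType d) (R : realType)
    (mu : {measure set T -> \bar R}) (D : set T) (f g : T -> \bar R) :
  (forall x, D x -> (0 <= f x)%E) -> (forall x, D x -> (f x <= g x)%E) ->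
  (\int[mu]_(x in D) f x <= \int[mu]_(x in D) g x)%E.
Proof.
move=> f0 fg; rewrite !ge0_integralE//; last first.
  by move=> x Dx; exact: le_trans (f0 x Dx) (fg x Dx).
apply: ereal_sup_le; apply: image_subset => h /= hf x.
apply: le_trans (hf x) _; rewrite /patch; case: ifPn => // xD.
by apply: fg; rewrite -in_setE.
Qed.

Context {R : realType} {S : manifold R 2} (sigma : metric S).
Variables (S_closed : compact [set: S]).
Variables (mu : {measure set (borel_surface S) -> \bar R}).
Hypothesis mu_area : is_area_measure sigma mu.

Lemma open_borel (A : set S) : open A -> measurable (A : set (borel_surface S)).
Proof. exact: sub_sigma_algebra. Qed.

Lemma continuous_borel (f : S -> R) : continuous f ->
  measurable_fun [set: borel_surface S] f.
Proof.
move=> /continuousP cf _; apply: (measurability _ (measurable_realfun.RGenOpens.measurableE R)) => //.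
move=> _ [_ [a [b ->] <-]]; rewrite setTI; apply: open_borel.
by apply: cf; exact: interval_open.
Qed.

(** Rows carry the sup norm, so a coordinate ball is a product of intervals and product measure
    computes its size. *)
Lemma rV2_ball (x : 'rV[R]_2) (e : R) : 0 < e ->
  [set z | ball x e (rV2 z)] = ball (x 0 0) e `*` ball (x 0 1) e.
Proof.
move=> e0; apply/seteqP; split=> -[z1 z2] /=.
  move=> [_ xz]; split; have := xz 0; first by move=> /(_ 0); rewrite mxE.
  by move=> /(_ 1); rewrite mxE.
move=> [xz1 xz2]; split=> // i j; rewrite (ord1 i) mxE /=.
have [->|->] // : j = 0 \/ j = 1.
by case: j => -[|[|//]] j2; [left|right]; exact: val_inj.
Qed.

(** On a small coordinate ball the area density stays below its value at the centre plus 1, so the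
    area is at most that bound times the measure of a square. *)
Lemma locally_finite_area (p : S) :
  exists A : set S, [/\ open A, A p & (mu A < +oo)%E].
Proof.
have Ad := chart_at_atlas p; have dp := chart_at_dom p.
set d := chart_at p in Ad dp; have [dx xE] := coordK dp; set x := coord d p in dx xE.
pose f (y : 'rV[R]_2) := Num.sqrt (\det (gcomp sigma d y)).
have cf : {for x, continuous f}.
  apply: (@continuous_comp _ _ _ (fun y => \det (gcomp sigma d y)) Num.sqrt).
    apply/C1_continuous/C1_det => i j.
    exact: smooth_C1_entry (@cod_open _ _ _ d) (metric_smooth sigma Ad) dx.
  exact: sqrt_continuous.
have : \forall y \near x, cod d y /\ f y < f x + 1.
  apply: filterI; first exact: near_cod.
  by apply: (cf [set t | t < f x + 1]); apply: lt_nbhsl; rewrite ltrDl.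
move=> /nbhs_ballP[e /= e0 xe].
pose A : set S := dom d `&` coord d @^-1` ball x e.
have oA : open A.
  rewrite openE => q [dq xq]; apply: filterI.
    exact: open_nbhs_nbhs (conj (dom_open d) dq).
  apply: (Defs.coord_continuous dq); apply: open_nbhs_nbhs; split=> //.
  exact: ball_open.
exists A; split => //; first by split=> //; exact: ballxx.
(* The coordinate image of [A], over which the density is integrated, is the full ball because the
   ball lies in [cod d]. *)
have AE : [set z | (coord d @` A) (rV2 z)] = ball (x 0 0) e `*` ball (x 0 1) e.
  rewrite -rV2_ball//; apply/seteqP; split=> z /=.
    by move=> [q [dq xq] <-].
  move=> xz; have [dz _] := xe _ xz; have [dpz zE] := paraK dz.
  by exists (para d (rV2 z)) => //; split=> //=; rewrite zE.
rewrite (mu_area Ad (open_borel oA)); last by move=> q [].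
rewrite AE.
apply: le_lt_trans.
  apply: (@ge0_integral_le _ _ _ _ _ _ (cst (f x + 1)%:E)) => z; rewrite -rV2_ball//= => xz.
  by rewrite lee_fin; have [_ /ltW] := xe _ xz.
rewrite integral_cst; last by apply: measurableX; rewrite ball_itv; exact: measurable_itv.
have mball (t : R) : measurable (ball t e : set R) by rewrite ball_itv; exact: measurable_itv.
have boxE := product_measure1E (@lebesgue_measure R) (@lebesgue_measure R)
  (mball (x 0 0)) (mball (x 0 1)).
rewrite [X in (_ * X)%E]boxE.
by rewrite /= !lebesgue_measure_ball ?(ltW e0)// -!EFinM ltry.
Qed.

(** Compactness extracts a finite subcover from the sets of [locally_finite_area]; subadditivity
    concludes. *)
Lemma finite_area : (mu [set: S] < +oo)%E.
Proof.
pose A p := sval (cid (locally_finite_area p)).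
have AP p : [/\ open (A p), A p p & (mu (A p) < +oo)%E].
  exact: svalP (cid (locally_finite_area p)).
have := S_closed; rewrite compact_cover => /(_ S setT A).
case; [by move=> p _; have [] := AP p|by move=> p _; exists p => //; have [] := AP p|].
move=> D _ DA; have oU (s : seq S) : open (\big[setU/set0]_(p <- s) A p).
  elim: s => [|p s IH]; first by rewrite big_nil; exact: open0.
  by rewrite big_cons; apply: openU => //; have [] := AP p.
have -> : [set: S] = \big[setU/set0]_(p <- finmap.enum_fset D) A p.
  by apply/seteqP; split=> // q /DA; rewrite -bigcup_fset.
elim: (finmap.enum_fset D) => [|p s IH]; first by rewrite big_nil measure0.
rewrite big_cons; apply: le_lt_trans (measureU2 _ _ _) _.
- by apply: open_borel; have [] := AP p.
- exact: open_borel.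
- by apply: lte_add_pinfty => //; have [] := AP p.
Qed.

Lemma continuous_integrable (f : S -> R) : continuous f ->
  mu.-integrable [set: borel_surface S] (EFin \o f).
Proof.
move=> cf; apply: measurable_bounded_integrable.
- exact: measurableT.
- exact: finite_area.
- exact: continuous_borel.
- have /compact_bounded[M [Mreal Mf]] : compact (f @` setT : set R^o).
    by apply: continuous_compact => //; exact: continuous_subspaceT.
  by exists M; split=> // r Mr x _; apply: Mf => //; exists x.
Qed.

End Integration.

(** * Null frames of a normal plane and uniqueness of the reflection *)

Section NullFrames.
Context {R : realType} (n : nat) (G : 'M[R]_(n + 2)) (P : 'M[R]_(n, n + 2)).
Hypotheses (sG : G^T = G) (Gu : G \in unitmx) (PGP : P *m G *m P^T \in unitmx).
Implicit Types (l k v T H : 'rV[R]_(n + 2)).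

(** The rows of [P] stand for tangent vectors. The size [n + 2] encodes codimension two and is
    convertible to 4 for [n = 2]. *)
Definition normal_to v : Prop := v *m G *m P^T = 0.

(** The rows of [P] with [l] and [k] form a basis, and a vector is determined by its products with a
    basis since [G] is invertible. As [l] and [k] are null, pairing with one isolates the
    coefficient of the other. *)
Lemma null_frame_expansion l k v : normal_to l -> normal_to k -> normal_to v ->
  bform G l l = 0 -> bform G k k = 0 -> bform G l k != 0 ->
  v = (bform G v k / bform G l k) *: l + (bform G v l / bform G l k) *: k.
Proof.
move=> nl nk nv ll kk lk0; set c := bform G l k in lk0 *.
have kl : bform G k l = c by rewrite bformC.
pose Q := col_mx P (col_mx l k).
have Qfree : row_free Q.
  apply: inj_row_free => u; rewrite -[u]hsubmxK -[rsubmx u]hsubmxK.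
  set u1 := lsubmx u; set s := lsubmx (rsubmx u); set t := rsubmx (rsubmx u).
  rewrite !mul_row_col => uQ.
  have sE : s = (s 0 0)%:M by rewrite -mx11_scalar.
  have tE : t = (t 0 0)%:M by rewrite -mx11_scalar.
  have nPv w : normal_to w -> (P *m G *m w^T) = 0.
    by move=> nw; apply: trmx_inj; rewrite !trmx_mul trmxK sG trmx0 mulmxA.
  (* Pairing a vanishing combination with a normal vector removes its tangential part. *)
  have pair w : normal_to w -> s 0 0 * bform G l w + t 0 0 * bform G k w = 0.
    move=> nw; have := congr1 (fun z => (z *m G *m w^T) 0 0) uQ.
    rewrite !mulmxDl !mul0mx -!(mulmxA u1) (nPv _ nw) mulmx0 add0r mxE.
    rewrite {1}sE {1}tE !mul_scalar_mx -!scalemxAl /bform !mxE.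
    exact.
  have := pair _ nk; rewrite kk mulr0 addr0 => /eqP; rewrite mulf_eq0 (negbTE lk0) orbF.
  move=> /eqP s0; have := pair _ nl; rewrite ll mulr0 add0r kl => /eqP.
  rewrite mulf_eq0 (negbTE lk0) orbF => /eqP t0.
  have s0' : s = 0 by rewrite sE s0 raddf0.
  have t0' : t = 0 by rewrite tE t0 raddf0.
  (* Only tangential coefficients remain; the invertible Gram matrix [P *m G *m P^T] kills them. *)
  move: uQ; rewrite s0' t0' !mul0mx !addr0 => /(congr1 (fun z => z *m G *m P^T)).
  rewrite !mul0mx -!(mulmxA u1) => /(canRL (mulmxK PGP)) ->.
  by rewrite mul0mx !row_mx0.
set w := _ + _; apply/eqP; rewrite -subr_eq0; apply/eqP.
have wl : bform G (v - w) l = 0.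
  by rewrite bformDl bformNl bformDl !bformZl ll kl mulr0 add0r divfK// subrr.
have wk : bform G (v - w) k = 0.
  by rewrite bformDl bformNl bformDl !bformZl kk mulr0 addr0 divfK// subrr.
have wP : (v - w) *m G *m P^T = 0.
  by rewrite !mulmxBl nv !mulmxDl -!scalemxAl nl nk !scaler0 addr0 subrr.
have : (v - w) *m G *m Q^T = 0.
  rewrite /Q !tr_col_mx !mul_mx_row wP.
  have zE z : bform G (v - w) z = 0 -> (v - w) *m G *m z^T = 0.
    by move=> z0; apply/rowP => i; rewrite [i]ord1 [RHS]mxE.
  by rewrite !zE// !row_mx0.
have Qu : Q^T \in unitmx by rewrite unitmx_tr -row_free_unit.
by move=> /(canRL (mulmxK Qu)); rewrite mul0mx => /(canRL (mulmxK Gu)); rewrite mul0mx.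
Qed.

Definition future_null_vector (T v : 'rV[R]_(n + 2)) : Prop :=
  bform G v v = 0 /\ bform G v T < 0.

(* A null normal vector is a multiple of [l] or of [k]; the sign of its product
   with [H] tells which, since [l] and [k] lie on different sides of [H]. *)
Lemma null_normal_line T H l k v : normal_to l -> normal_to k -> normal_to v ->
  future_null_vector T l -> future_null_vector T k -> future_null_vector T v ->
  bform G l k != 0 -> 0 < bform G l H -> bform G k H < 0 -> 0 < bform G v H ->
  exists s, v = s *: l.
Proof.
move=> nl nk nv [ll _] [kk kT] [vv vT] lk0 lH kH vH.
have := null_frame_expansion nl nk nv ll kk lk0.
move: (bform G v k / _) (bform G v l / _) => s t vE; move: vv vT vH; rewrite {}vE.
rewrite !bformDl !bformZl !bformDr !bformZr ll kk (bformC k l sG) => vv vT vH.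
have [t0|t0] := eqVneq t 0; first by exists s; rewrite t0 scale0r addr0.
have s0 : s = 0.
  apply/eqP; move/eqP: vv; rewrite !mulr0 add0r addr0.
  have -> : s * (t * bform G l k) + t * (s * bform G l k) = 2 * (t * bform G l k) * s by ring.
  by rewrite !mulf_eq0 (negbTE t0) (negbTE lk0) pnatr_eq0.
move: vT vH; rewrite s0 !mul0r !add0r => vT vH.
have tp : 0 < t by rewrite -(nmulr_llt0 _ kT).
by move: vH; rewrite pmulr_rgt0// ltNge ltW.
Qed.

(** [H] determines both null lines, so the two frames differ by rescaling and the coefficients of
    [H] rescale inversely. *)
Lemma reflection_unique T H l k l' k' (a b a' b' : R) :
  normal_to l -> normal_to k -> normal_to l' -> normal_to k' ->
  future_null_vector T l -> future_null_vector T k ->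
  future_null_vector T l' -> future_null_vector T k' ->
  0 < bform G l H -> bform G k H < 0 -> 0 < bform G l' H -> bform G k' H < 0 ->
  H = a *: l + b *: k -> H = a' *: l' + b' *: k' ->
  a *: l - b *: k = a' *: l' - b' *: k'.
Proof.
move=> nl nk nl' nk' fl fk fl' fk' lH kH l'H k'H HE HE'.
(* Otherwise [l] would be orthogonal to [l] and [k], hence to [H]. *)
have lk0 : bform G l k != 0.
  apply: contraTneq lH => lk; rewrite HE bformDr !bformZr fl.1 lk !mulr0 addr0.
  by rewrite ltxx.
have HN v : bform G v (- H) = - bform G v H by rewrite -scaleN1r bformZr mulN1r.
have [s l'E] : exists s, l' = s *: l.
  exact: (null_normal_line nl nk nl' fl fk fl' lk0 lH kH l'H).
(* The outgoing line is the incoming one for [- H], with [l] and [k] exchanged. *)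
have [t k'E] : exists t, k' = t *: k.
  apply: (@null_normal_line T (- H) k l k') => //; rewrite ?HN ?oppr_gt0 ?oppr_lt0//.
  by rewrite bformC.
move: HE'; rewrite l'E k'E !scalerA {}HE => HE.
have aE : a = a' * s.
  have := congr1 (bform G ^~ k) HE; rewrite !bformDl !bformZl fk.1 !mulr0 !addr0.
  exact: mulIf.
have bE : b = b' * t.
  have := congr1 (bform G ^~ l) HE; rewrite !bformDl !bformZl fl.1 !mulr0 !add0r.
  by apply: mulIf; rewrite bformC.
by rewrite -aE -bE.
Qed.

End NullFrames.

(** * Effect of a translation on the data of the embedding *)

Section Translation.
Context {R : realType} {S : manifold R 2} (sigma : metric S).
Hypothesis sigma_riem : riemannian sigma.
Variables (X : S -> minkowski_space R) (X_iso : isometric_embedding sigma X).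
Variables (b : 'rV[R]_4).
Local Notation std := (std_chart 4).
Local Notation eta := (minkowski_form R).
Local Notation X' := (fun p => (X p : 'rV[R]_4) + b : minkowski_space R).
Variables (E0 : extrinsic_data sigma X) (E0' : extrinsic_data sigma X').
Implicit Types (d : chart R S 2) (p : S).

(** The difference quotients coincide, which gives an equality of functions that can be
    differentiated again. *)
Lemma partial_shift m (V : normedModType R) (u : 'rV[R]_m -> V) (v : V) a :
  partial a (fun y => u y + v) = partial a u.
Proof.
apply/funext => x; rewrite /partial /derive.
suff -> : (fun h : R => h^-1 *: (((fun y => u y + v) \o shift x) (h *: delta_mx 0 a) -
    (u x + v))) = (fun h => h^-1 *: ((u \o shift x) (h *: delta_mx 0 a) - u x)) by [].
by apply/funext => h /=; rewrite opprD addrACA subrr addr0.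
Qed.

Lemma minkowski_form_unit : eta \in unitmx.
Proof.
rewrite unitmxE det_diag unitfE; apply/prodf_neq0 => i _.
by rewrite mxE; case: ifP => _; rewrite ?oppr_eq0 oner_neq0.
Qed.

Lemma mean_curvature_local_shift m n (g : 'rV[R]_m -> 'M[R]_m) (G : 'M[R]_n)
    (f : 'rV[R]_m -> 'rV[R]_n) (v : 'rV[R]_n) x :
  mean_curvature_local g (fun=> G) (fun y => f y + v) x =
  mean_curvature_local g (fun=> G) f x.
Proof.
rewrite /mean_curvature_local; apply: eq_bigr => a _; apply: eq_bigr => c _.
rewrite !cov_along_cst (partial_shift f v).
suff -> : (fun e => partial e (fun y => f y + v) x) = (fun e => partial e f x) by [].
by apply/funext => e; rewrite (partial_shift f v).
Qed.

Lemma mcv_translation p : vcomp (mcv E0') std p = vcomp (mcv E0) std p.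
Proof.
have Ad := chart_at_atlas p; have dp := chart_at_dom p.
have HE' := mcvP E0' Ad (@atlas_std R) dp Logic.I.
have HE := mcvP E0 Ad (@atlas_std R) dp Logic.I.
apply: etrans HE' _; apply: etrans _ (esym HE).
exact: (mean_curvature_local_shift _ _ (local_rep X (chart_at p) std)).
Qed.

Lemma inner_std (Y : S -> minkowski_space R) (V W : vfield_along Y) p :
  inner V W p = bform eta (vcomp V std p) (vcomp W std p).
Proof. exact: (inner_chartE V W (@atlas_std R) Logic.I). Qed.

Lemma inner_translation : inner (mcv E0') (mcv E0') = inner (mcv E0) (mcv E0).
Proof. by apply/funext => p; rewrite !inner_std mcv_translation. Qed.

Lemma mc_norm_translation : mc_norm E0' = mc_norm E0.
Proof. by apply/funext => p; rewrite /mc_norm inner_translation. Qed.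

(** Each of [E0] and [E0'] brings its own null frame of the same normal plane, with the same [H];
    [reflection_unique] reconciles them. *)
Lemma reflection_translation p : vcomp (mcv_refl E0') std p = vcomp (mcv_refl E0) std p.
Proof.
have Ad := chart_at_atlas p; have dp := chart_at_dom p.
set d := chart_at p in Ad dp; have [dx _] := coordK dp; set x := coord d p in dx.
pose J := jacobian (local_rep X d std) x.
(* By isometry this is [gcomp sigma d x], invertible because [sigma] is Riemannian. *)
have JJ : J *m eta *m J^T \in unitmx.
  have [_ _ /(_ d std x Ad (@atlas_std R))] := X_iso.
  rewrite overlap_std => /(_ dx) /= <-.
  exact: gcomp_unit.
have normalE v : (forall a, bform eta v (partial a (local_rep X d std) x) = 0) ->
    @normal_to R 2 eta J v.
  move=> nv; apply/rowP => a; rewrite [RHS]mxE -(nv a) -(partial_local_rep_row X_iso)//.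
  rewrite /bform [LHS]mxE [RHS]mxE; apply: eq_bigr => i _; congr (_ * _).
  by rewrite !mxE.
have [l [k [a [c [[nl nk] [fl fk] [lH kH] HE ->]]]]] :=
  mcv_reflP E0 Ad (@atlas_std R) dp Logic.I.
have [l' [k' [a' [c' [[nl' nk'] [fl' fk'] [lH' kH'] HE' ->]]]]] :=
  mcv_reflP E0' Ad (@atlas_std R) dp Logic.I.
have localE : local_rep X' d std = (fun y => local_rep X d std y + b) by [].
have nl'' : @normal_to R 2 eta J l'.
  by apply: normalE => i; have := nl' i; rewrite localE (partial_shift (local_rep X d std) b).
have nk'' : @normal_to R 2 eta J k'.
  by apply: normalE => i; have := nk' i; rewrite localE (partial_shift (local_rep X d std) b).
rewrite mcv_translation in HE' lH' kH'.
have fE q v : @future_null R (minkowski_space R) std q v -> @future_null_vector R 2 eta (delta_mx 0 0) v.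
  by case.
apply/esym.
apply: (@reflection_unique R 2 eta J minkowski_form_sym minkowski_form_unit JJ _ _ _ _ _ _ _ _ _ _ _ _ nl'' nk''
  (fE _ _ fl) (fE _ _ fk) (fE _ _ fl') (fE _ _ fk') lH kH lH' kH' HE HE').
- exact: normalE.
- exact: normalE.
Qed.

Lemma alphaH_translation d p : atlas d -> dom d p ->
  ocomp (alphaH E0') d p = ocomp (alphaH E0) d p.
Proof.
move=> Ad dp; apply/rowP => a.
rewrite (alphaHP E0' a Ad (@atlas_std R) dp Logic.I).
rewrite (alphaHP E0 a Ad (@atlas_std R) dp Logic.I).
rewrite /= !cov_along_cst inner_translation mcv_translation.
(* The normalised reflection is differentiated here, so it must agree at all points and not only at
   [p]. *)
suff -> : (fun y => (Num.sqrt (inner (mcv E0) (mcv E0) (para d y)))^-1 *: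
      vcomp (mcv_refl E0') std (para d y)) =
    (fun y => (Num.sqrt (inner (mcv E0) (mcv E0) (para d y)))^-1 *:
      vcomp (mcv_refl E0) std (para d y)) by [].
by apply/funext => y; rewrite reflection_translation.
Qed.

Variable T0 : 'rV[R]_4.

Lemma tau_translation : tau X' T0 = (fun p => tau X T0 p - bform eta b T0).
Proof. by apply/funext => p; rewrite /tau bformDl opprD. Qed.

Lemma partial_tau_translation d a :
  partial a (tau X' T0 \o para d) = partial a (tau X T0 \o para d).
Proof. have -> : tau X' T0 \o para d = (fun y => (tau X T0 \o para d) y - bform eta b T0).
  by apply/funext => y; rewrite /= tau_translation.
exact: partial_shift. Qed.

Lemma laplacian_tau_translation :
  laplacian sigma (tau X' T0) = laplacian sigma (tau X T0).
Proof.
apply/funext => p; rewrite /laplacian; apply: eq_bigr => a _; apply: eq_bigr => c _.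
rewrite !partial_tau_translation; congr (_ * (_ - _)).
by apply: eq_bigr => e _; rewrite /pd partial_tau_translation.
Qed.

Lemma grad_sq_tau_translation :
  grad_sq sigma (tau X' T0) = grad_sq sigma (tau X T0).
Proof.
apply/funext => p; rewrite /grad_sq; apply: eq_bigr => a _; apply: eq_bigr => c _.
by rewrite /pd !partial_tau_translation.
Qed.

Variables (N : spacetime R) (F : S -> N) (E : extrinsic_data sigma F).

Lemma rho_translation : rho E E0' T0 = rho E E0 T0.
Proof.
apply/funext => p.
by rewrite /rho mc_norm_translation laplacian_tau_translation grad_sq_tau_translation.
Qed.

Lemma position_translation g p : position X' g p = position X g p + b 0 g.
Proof. by rewrite /position mxE. Qed.

Lemma current_translation d p a : atlas d -> dom d p ->
  current E E0' T0 d p a = current E E0 T0 d p a.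
Proof.
move=> Ad dp; rewrite /current; apply: eq_bigr => c _.
rewrite rho_translation mc_norm_translation laplacian_tau_translation.
by rewrite (alphaH_translation Ad dp) /pd partial_tau_translation.
Qed.

Lemma current_deriv_translation g : current_deriv E E0' T0 g = current_deriv E E0 T0 g.
Proof.
apply/funext => p; rewrite /current_deriv; apply: eq_bigr => a _.
rewrite current_translation; [|exact: chart_at_atlas|exact: chart_at_dom].
congr (_ * _); rewrite /pd.
set d := chart_at p.
have -> : position X' g \o para d = (fun y => (position X g \o para d) y + b 0 g).
  by apply/funext => y; rewrite /= position_translation.
by rewrite (partial_shift (position X g \o para d)).
Qed.

End Translation.

Theorem theorem4p1 (R : realType) (N : spacetime R)
  (Sigma : manifold R 2) (Sigma_closed : compact [set: Sigma])
  (sigma : metric Sigma) (sigma_riem : riemannian sigma)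
  (F : Sigma -> N) (F_iso : isometric_embedding sigma F)
  (E : extrinsic_data sigma F)
  (dSigma : {measure set (borel_surface Sigma) -> \bar R})
  (dSigmaP : is_area_measure sigma dSigma)
  (X : Sigma -> minkowski_space R) (X_iso : isometric_embedding sigma X)
  (E0 : extrinsic_data sigma X)
  (T0 : 'rV[R]_4) (T0_unit : bform (minkowski_form R) T0 T0 = -1)
  (T0_future : 0 < T0 0 0)
  (b : 'rV[R]_4)
  (E0' : extrinsic_data sigma (fun p => (X p : 'rV[R]_4) + b : minkowski_space R))
  (alpha gamma : 'I_4) :
  conserved_quantity sigma E E0' T0 dSigma alpha gamma =
    conserved_quantity sigma E E0 T0 dSigma alpha gamma
    - b 0 alpha * energy_momentum sigma E E0 T0 dSigma gamma / 2
    + b 0 gamma * energy_momentum sigma E E0 T0 dSigma alpha / 2.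
Proof.
have [_ smF _] := F_iso.
(* [P g] is the density of the energy-momentum and [Q] that of the conserved quantity, both without
   their constant prefactors. *)
pose P g p := rho E E0 T0 p * T0 0 g + current_deriv E E0 T0 g p.
pose Q p := (position X alpha p * T0 0 gamma - position X gamma p * T0 0 alpha) *
    rho E E0 T0 p +
  (position X alpha p * current_deriv E E0 T0 gamma p -
   position X gamma p * current_deriv E E0 T0 alpha p).
have c_pos g : continuous (position X g).
  exact: C1_surface_continuous (C1_position X_iso g).
have c_rho : continuous (rho E E0 T0).
  exact: C1_surface_continuous (C1_rho sigma_riem smF E X_iso E0 T0).
have c_cd g : continuous (current_deriv E E0 T0 g).
  exact: continuous_current_deriv.
have c_cst (k : R) : continuous ((fun=> k) : Sigma -> R) by move=> p; exact: cst_continuous.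
have c_P g : continuous (P g).
  move=> p; exact: (continuousD (continuousM (c_rho p) (c_cst (T0 0 g) p)) (c_cd g p)).
have c_Q : continuous Q.
  move=> p; apply: (continuousD (continuousM _ (c_rho p)) _).
    exact: (continuousB (continuousM (c_pos alpha p) (c_cst (T0 0 gamma) p))
      (continuousM (c_pos gamma p) (c_cst (T0 0 alpha) p))).
  exact: (continuousB (continuousM (c_pos alpha p) (c_cd gamma p))
    (continuousM (c_pos gamma p) (c_cd alpha p))).
have int f := @continuous_integrable _ _ _ Sigma_closed _ dSigmaP f.
have c_bP k g : continuous (fun p => k * P g p).
  by move=> p; exact: (continuousM (c_cst k p) (c_P g p)).
(* Only the undifferentiated factors X^alpha and X^gamma feel the translation, and each contributes
   a component of [b] times [P]. *)
have -> : conserved_quantity sigma E E0' T0 dSigma alpha gamma =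
    - (16 * pi)^-1 * \int[dSigma]_p (Q p + b 0 alpha * P gamma p - b 0 gamma * P alpha p).
  rewrite /conserved_quantity; congr (_ * _); apply: eq_Rintegral => p _.
  rewrite (rho_translation E0).
  rewrite !(current_deriv_translation sigma_riem X_iso E0).
  rewrite !position_translation /P /Q; ring.
rewrite RintegralB//; first last.
- exact: int (c_bP _ _).
- apply: int => p; exact: (continuousD (c_Q p) (c_bP (b 0 alpha) gamma p)).
rewrite RintegralD//; [|exact: int c_Q|exact: int (c_bP _ _)].
rewrite !RintegralZl//; [|exact: int (c_P _)..].
(* Here [c] stands for pi; 1/(16 c) is half of 1/(8 c), whence the halves. *)
have combine (c q u v s t : R) : c != 0 ->
    - (16 * c)^-1 * (q + u * s - v * t) =
    - (16 * c)^-1 * q - u * ((8 * c)^-1 * s) / 2 + v * ((8 * c)^-1 * t) / 2.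
  by move=> c0; field.
by apply: combine; rewrite gt_eqF// pi_gt0.
Qed.
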